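(* Let $Q$ be a quasifield. The following conditions are equivalent: (1) $Q$ is differentially closed. (2) For every natural number $n$ and every proper differential ideal $\mathfrak a$ of $Q\{y_1,\ldots,y_n\}$, the set $V(\mathfrak a)\subseteq Q^n$ of common zeros of $\mathfrak a$ is not empty. (3) Any quasifield differentially finitely generated over $Q$ coincides with $Q$. (4) Any quasifield differentially generated over $Q$ by one single element coincides with $Q$. (5) Any quasifield differentially generated over $Q$ by an at most countable set of elements coincides with $Q$. (6) $Q$ is isomorphic, as a differential ring, to the Hurwitz series ring $\operatorname{H}K$ over some uncountable algebraically closed field $K$.
   Context: A differential ring is a commutative associative unital ring with a fixed finite nonempty set $\Delta$ of pairwise commuting derivations (the same $\Delta$ for all rings). $\Theta$ is the free commutative monoid generated by $\Delta$, acting as derivative operators. All rings have nonzero characteristic; homomorphisms are unital, and differential homomorphisms commute with $\Delta$. A quasifield is a nonzero differential ring of nonzero characteristic whose only differential ideals are $0$ and the whole ring. (It is known that a quasifield is a local ring of Krull dimension $0$, of prime characteristic $p$, with maximal ideal $\{x\mid x^p=0\}$.) $Q\{y_1,\ldots,y_n\}$ is the ring of differential polynomials, i.e. the polynomial ring over $Q$ in the indeterminates $\theta y_i$ ($\theta\in\Theta$, $1\le i\le n$) with the obvious derivations. For $E\subseteq Q\{y_1,\ldots,y_n\}$, $V(E)\subseteq Q^n$ is the set of common zeros of $E$ in $Q^n$; for $X\subseteq Q^n$, $I(X)$ is the set of differential polynomials vanishing on $X$. For a differential ideal $\mathfrak a$, $\mathfrak{rad}(\mathfrak a)=\{f\mid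 \theta f \text{ is nilpotent modulo } \mathfrak a \text{ for all }\theta\in\Theta\}$. The quasifield $Q$ is differentially closed if $\mathfrak{rad}(\mathfrak a)=I(V(\mathfrak a))$ for every natural number $n$ and every differential ideal $\mathfrak a$ of $Q\{y_1,\ldots,y_n\}$. A quasifield $L$ containing $Q$ (as a differential subring) is differentially generated over $Q$ by a set $S\subseteq L$ if $L$ is generated as a $Q$-algebra (as a ring) by the elements $\theta s$, $\theta\in\Theta$, $s\in S$. ''$L$ coincides with $Q$'' means that the inclusion $Q\to L$ is an isomorphism. Hurwitz series ring: let $\Delta=\{\delta_1,\ldots,\delta_m\}$ and identify $\Theta$ with $\mathbb N^m$. For a commutative ring $A$, $\operatorname{H}A$ is the set of families $(a_\alpha)_{\alpha\in\mathbb N^m}$ of elements of $A$ with componentwise addition, multiplication $(ab)_\gamma=\sum_{\alpha+\beta=\gamma}\binom{\gamma}{\alpha}a_\alpha b_\beta$ (multi-index binomial coefficients), and derivations $(\delta_i a)_\alpha=a_{\alpha+e_i}$. *)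

(* Defs.v *)
From HB Require Import structures.
From mathcomp Require Import all_boot all_order all_algebra.
From mathcomp Require Import finmap.
From mathcomp Require Import boolp classical_sets functions cardinality.
From mathcomp.multinomials Require Import monalg.

Set Implicit Arguments.
Unset Strict Implicit.
Unset Printing Implicit Defensive.

Import GRing.Theory.

Local Open Scope classical_set_scope.
Local Open Scope ring_scope.

(** * Differential rings *)

HB.mixin Record ComNzRing_isDifferential (Delta : finType) R
    of GRing.ComNzRing R := {
  der : Delta -> R -> R;
  derD : forall d, {morph der d : x y / x + y};
  derM : forall d x y, der d (x * y) = der d x * y + x * der d y;
  derC : forall d e x, der d (der e x) = der e (der d x)
}.

#[short(type="diffRingType")]
HB.structure Definition DiffRing (Delta : finType) :=
  {R of GRing.ComNzRing R & ComNzRing_isDifferential Delta R}.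

(* The free commutative monoid on [Delta], as multi-indices. *)
Notation Theta Delta := {ffun Delta -> nat}.

(* The derivations commute, so the order of [enum Delta] is irrelevant. *)
Definition theta_act (Delta : finType) (R : diffRingType Delta)
    (theta : Theta Delta) (x : R) : R :=
  foldr (fun d y => iter (theta d) (der d) y) x (enum Delta).

(* Not necessarily proper. *)
Record diff_ideal (Delta : finType) (R : diffRingType Delta) (a : set R)
    : Prop := DiffIdeal {
  diff_ideal0 : a 0;
  diff_idealD : forall x y, a x -> a y -> a (x + y);
  diff_idealM : forall r x, a x -> a (r * x);
  diff_ideal_deriv : forall d x, a x -> a (der d x)
}.

Definition diff_rad (Delta : finType) (R : diffRingType Delta) (a : set R)
    : set R :=
  [set f | forall theta : Theta Delta, exists k, a (theta_act theta f ^+ k)].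

Record quasifield (Delta : finType) (Q : diffRingType Delta) : Prop :=
    Quasifield {
  quasifield_char : exists2 n, (0 < n)%N & n%:R = 0 :> Q;
  quasifield_simple :
    forall a : set Q, diff_ideal a -> a = [set 0] \/ a = [set: Q]
}.

Record quasifield_ext (Delta : finType) (Q L : diffRingType Delta)
    (i : {rmorphism Q -> L}) : Prop := QuasifieldExt {
  ext_quasifield : quasifield L;
  ext_inj : injective i;
  ext_deriv : forall d x, i (der d x) = der d (i x)
}.

Definition diff_generated (Delta : finType) (Q L : diffRingType Delta)
    (i : {rmorphism Q -> L}) (S : set L) : Prop :=
  forall B : {pred L}, GRing.subring_closed B ->
    (forall q, i q \in B) ->
    (forall (theta : Theta Delta) s, S s -> theta_act theta s \in B) ->
  forall x, x \in B.

Definition diff_ring_isomorphic (Delta : finType) (R S : diffRingType Delta)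
    : Prop :=
  exists2 f : {rmorphism R -> S}, bijective f &
    forall d x, f (der d x) = der d (f x).

Lemma der0 (Delta : finType) (R : diffRingType Delta) d : der d (0 : R) = 0.
Proof. by apply: (addIr (der d 0)); rewrite -derD !add0r. Qed.

Lemma der1 (Delta : finType) (R : diffRingType Delta) d : der d (1 : R) = 0.
Proof.
have := derM d (1 : R) 1; rewrite !mulr1 !mul1r => H.
by apply: (addIr (der d 1)); rewrite add0r -H.
Qed.

(** * Differential polynomials *)

(* A derivation of a monoid algebra, from a derivation [D] of the coefficients
   and its values [Dm] on the monomials. *)
Section MalgDeriv.
Context (Q : comNzRingType) (M : conomType).
Local Notation P := {malg Q[M]}.
Implicit Types (f g : P) (k l m : M) (a b c : Q).

Definition malg_deriv (D : Q -> Q) (Dm : M -> P) f : P :=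
  \sum_(m <- msupp f) (<< D f@_m *g m >> + f@_m *: Dm m).

Lemma malgUM a b k l :
  << a *g k >> * << b *g l >> = << a * b *g mmul k l >> :> P.
Proof. exact: fgmulUU. Qed.

Lemma malgUZ a b k : a *: << b *g k >> = << a * b *g k >> :> P.
Proof. by apply/malgP => l; rewrite mcoeffZ !mcoeffU mulrnAr. Qed.

Lemma malgU_Z a k : << a *g k >> = a *: << k >> :> P.
Proof. by rewrite malgUZ mulr1. Qed.

Lemma malgU_split a b c k l m : c = a + b -> a = 0 \/ k = l ->
  b = 0 \/ k = m -> << c *g k >> = << a *g l >> + << b *g m >> :> P.
Proof.
by move=> -> [->|->] [->|<-]; rewrite ?(add0r, addr0, monalgU0, monalgUD).
Qed.

Lemma malg_ind (A : P -> Prop) :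
    (forall c m, A << c *g m >>) -> (forall f g, A f -> A g -> A (f + g)) ->
  forall f, A f.
Proof.
move=> AU AD f; rewrite (monalgE f); apply: big_ind => //.
by have := AU 0 mone; rewrite monalgU0.
Qed.

Context (D : Q -> Q) (DD : {morph D : x y / x + y}).
Context (DM : forall x y, D (x * y) = D x * y + x * D y).
Context (Dm : M -> P).
Context (DmM : forall k l, Dm (mmul k l) = Dm k * << l >> + << k >> * Dm l).

Let D0 : D 0 = 0.
Proof. by apply: (addIr (D 0)); rewrite -DD !add0r. Qed.

Lemma malg_derivEw f (S : {fset M}) : (msupp f `<=` S)%fset ->
  malg_deriv D Dm f = \sum_(m <- S) (<< D f@_m *g m >> + f@_m *: Dm m).
Proof.
move=> le; rewrite /malg_deriv (big_fset_incl _ le) // => m mS fm.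
by rewrite mcoeff_outdom // D0 monalgU0 scale0r addr0.
Qed.

Lemma malg_derivD : {morph malg_deriv D Dm : f g / f + g}.
Proof.
move=> f g; pose S := (msupp f `|` msupp g)%fset.
rewrite (@malg_derivEw f S) ?fsubsetUl // (@malg_derivEw g S) ?fsubsetUr //.
rewrite (@malg_derivEw _ S) ?msuppD_le // -big_split; apply: eq_bigr => m _.
by rewrite mcoeffD DD monalgUD scalerDl addrACA.
Qed.

Lemma malg_derivU c m :
  malg_deriv D Dm << c *g m >> = << D c *g m >> + c *: Dm m.
Proof. by rewrite (malg_derivEw msuppU_le) big_seq_fset1 mcoeffUU. Qed.

Lemma malg_derivM f g : malg_deriv D Dm (f * g) =
  malg_deriv D Dm f * g + f * malg_deriv D Dm g.
Proof.
elim/malg_ind: f => [a k | f1 f2 IH1 IH2]; last first.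
  by rewrite !(mulrDl, malg_derivD) IH1 IH2 addrACA.
elim/malg_ind: g => [b l | g1 g2 IH1 IH2]; last first.
  by rewrite !(mulrDr, malg_derivD) IH1 IH2 addrACA.
rewrite malgUM !malg_derivU DmM DM mulrDl mulrDr !malgUM -addrACA -monalgUD.
congr (_ + _); rewrite [<< a *g k >>]malgU_Z [<< b *g l >>]malgU_Z.
by rewrite -!scalerAl -!scalerAr !scalerA scalerDr.
Qed.

End MalgDeriv.

Lemma leibnizCM (P : pzRingType) (D E : P -> P) :
    {morph D : x y / x + y} -> (forall x y, D (x * y) = D x * y + x * D y) ->
    {morph E : x y / x + y} -> (forall x y, E (x * y) = E x * y + x * E y) ->
  forall x y, D (E x) = E (D x) -> D (E y) = E (D y) ->
  D (E (x * y)) = E (D (x * y)).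
Proof.
move=> DD DM ED EM x y Hx Hy.
by rewrite !(DM, EM, DD, ED) Hx Hy -!addrA; congr (_ + _); rewrite addrCA.
Qed.

Lemma malg_derivC (Q : comNzRingType) (M : conomType) (D E : Q -> Q)
    (Dm Em : M -> {malg Q[M]}) :
    {morph D : x y / x + y} -> {morph E : x y / x + y} ->
    (forall x y, D (x * y) = D x * y + x * D y) ->
    (forall x y, E (x * y) = E x * y + x * E y) ->
    (forall x, D (E x) = E (D x)) ->
    (forall k l, Dm (mmul k l) = Dm k * << l >> + << k >> * Dm l) ->
    (forall k l, Em (mmul k l) = Em k * << l >> + << k >> * Em l) ->
    (forall k, malg_deriv D Dm (malg_deriv E Em << k >>) =
               malg_deriv E Em (malg_deriv D Dm << k >>)) ->
  forall f, malg_deriv D Dm (malg_deriv E Em f) =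
            malg_deriv E Em (malg_deriv D Dm f).
Proof.
move=> DD ED DM EM DE DmM EmM H; elim/malg_ind => [c m | f g IHf IHg]; last first.
  by rewrite !(malg_derivD DD, malg_derivD ED) IHf IHg.
have -> : << c *g m >> = << c *g mone >> * << m >> :> {malg Q[M]}.
  by rewrite malgUM mulr1 mul1m.
apply: (leibnizCM (malg_derivD DD Dm) (malg_derivM DD DM DmM)
          (malg_derivD ED Em) (malg_derivM ED EM EmM)) => //.
have Dm1 : Dm mone = 0.
  have := DmM mone mone; rewrite mul1m mulr1 mul1r => H1.
  by apply: (addIr (Dm mone)); rewrite add0r -H1.
have Em1 : Em mone = 0.
  have := EmM mone mone; rewrite mul1m mulr1 mul1r => H1.
  by apply: (addIr (Em mone)); rewrite add0r -H1.
rewrite (malg_derivU ED) (malg_derivU DD) Dm1 Em1 scaler0 2!addr0.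
by rewrite (malg_derivU ED) (malg_derivU DD) Dm1 Em1 2!scaler0 DE.
Qed.

(* The variable [(i, theta)] stands for the derivative theta y_i. *)
Definition dvar (Delta : finType) (n : nat) := ('I_n * Theta Delta)%type.

HB.instance Definition _ Delta n := Choice.on (@dvar Delta n).

Definition incr (Delta : finType) (d : Delta) (theta : Theta Delta)
    : Theta Delta := [ffun e => theta e + (e == d)]%N.

Lemma incrC (Delta : finType) (d e : Delta) theta :
  incr d (incr e theta) = incr e (incr d theta).
Proof. by apply/ffunP => x; rewrite !ffunE addnAC. Qed.

Definition dvar_deriv (Delta : finType) n (d : Delta) (v : dvar Delta n)
    : dvar Delta n := (v.1, incr d v.2).

Section DMonom.
Context (Q : comNzRingType) (V : choiceType) (s : V -> V).
Local Notation mon := (cmonom V : conomType).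
Local Notation P := {malg Q[mon]}.
Implicit Types (m : cmonom V) (v : V).

(* The Leibniz rule on a monomial whose variables v have derivative [s v]: the
   sum of the (m v) * (m / v) * (s v) over the variables v of m; in it,
   [divcm m (ucm v)] is m / v. *)
Definition cmonom_deriv m : P :=
  \sum_(v <- finsupp m)
    << (m v)%:R *g mmul (divcm m (ucm v)) (ucm (s v)) >>.

Lemma cmonom_derivEw m (S : {fset V}) : (finsupp m `<=` S)%fset ->
  cmonom_deriv m = \sum_(v <- S)
    << (m v)%:R *g mmul (divcm m (ucm v)) (ucm (s v)) >>.
Proof.
move=> le; rewrite /cmonom_deriv (big_fset_incl _ le) // => v _ vm.
by rewrite fsfun_dflt // monalgU0.
Qed.

Lemma cmonom_derivM m1 m2 : cmonom_deriv (mmul m1 m2) =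
  cmonom_deriv m1 * << m2 >> + << m1 >> * cmonom_deriv m2.
Proof.
pose S := (finsupp m1 `|` finsupp m2)%fset.
rewrite (@cmonom_derivEw m1 S) ?fsubsetUl //.
rewrite (@cmonom_derivEw m2 S) ?fsubsetUr //.
rewrite (@cmonom_derivEw (mmul m1 m2) S) ?mdomD // mulr_suml.
rewrite [X in _ + X]mulr_sumr -big_split /=; apply: eq_bigr => v _.
rewrite [X in X + _]malgUM [X in _ + X]malgUM mulr1 mul1r.
apply: malgU_split; first exact: etrans (congr1 _ (mulcmE m1 m2 v)) (natrD _ _ _).
- case: (posnP (m1 v)) => [-> | m1v]; [by left | right].
  apply/eqP/cmP => w; rewrite !(mulcmE, divcmE, ucmE) [RHS]addnAC.
  congr (_ + _)%N.
  by case: (v =P w) => [<-|_]; [rewrite addnBAC | rewrite !subn0].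
- case: (posnP (m2 v)) => [-> | m2v]; [by left | right].
  apply/eqP/cmP => w; rewrite !(mulcmE, divcmE, ucmE) [RHS]addnA.
  congr (_ + _)%N.
  by case: (v =P w) => [<-|_]; [rewrite addnBA | rewrite !subn0].
Qed.

Lemma cmonom_derivX v : cmonom_deriv (ucm v) = << ucm (s v) >>.
Proof.
rewrite (@cmonom_derivEw _ [fset v]%fset) ?mdomU // big_seq_fset1.
have -> : mmul (divcm (ucm v) (ucm v)) (ucm (s v)) = ucm (s v).
  by apply/eqP/cmP => w; rewrite mulcmE divcmE subnn.
by have -> : ucm v v = 1%N by rewrite ucmE eqxx.
Qed.

Lemma cmonom_ind (A : cmonom V -> Prop) : A mone ->
  (forall v, A (ucm v)) -> (forall k l, A k -> A l -> A (mmul k l)) ->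
  forall m, A m.
Proof.
move=> A1 AX AM m; have [k] := ubnP (mdeg m).
elim: k m => // k IH m le.
case: (fset_0Vmem (finsupp m)) => [m0 | [v vm]].
  suff -> : m = mone by [].
  by apply/eqP/cmP => w; rewrite onecmE fsfun_dflt // m0 inE.
have Em : m = mmul (ucm v) (divcm m (ucm v)).
  apply/eqP/cmP => w; rewrite mulcmE divcmE ucmE.
  case: (v =P w) vm => [-> | _ _]; last by rewrite add0n subn0.
  by rewrite mem_finsupp -lt0n => /subnKC.
rewrite Em; apply: AM => //; apply: IH.
by move: le; rewrite {1}Em mdegM mdegU.
Qed.

End DMonom.

Definition dpoly (Delta : finType) (Q : diffRingType Delta) (n : nat) : Type :=
  {malg Q[{cmonom (dvar Delta n)}]}.

HB.instance Definition _ (Delta : finType) (Q : diffRingType Delta) n :=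
  GRing.ComNzRing.copy (@dpoly Delta Q n)
    {malg Q[{cmonom (dvar Delta n)}]}.

Section DPoly.
Context (Delta : finType) (Q : diffRingType Delta) (n : nat).
Local Notation P := (dpoly Q n).

Definition dpoly_deriv (d : Delta) (f : P) : P :=
  malg_deriv (der d) (cmonom_deriv Q (@dvar_deriv Delta n d)) f.

Lemma dpoly_derivD d : {morph dpoly_deriv d : f g / f + g}.
Proof. exact: (malg_derivD (derD d)). Qed.

Lemma dpoly_derivM d f g :
  dpoly_deriv d (f * g) = dpoly_deriv d f * g + f * dpoly_deriv d g.
Proof.
exact: (malg_derivM (derD d) (derM d) (@cmonom_derivM Q _ (dvar_deriv d))).
Qed.

Lemma dpoly_derivX d (v : dvar Delta n) :
  dpoly_deriv d << ucm v >> = << ucm (dvar_deriv d v) >>.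
Proof.
rewrite /dpoly_deriv (malg_derivU (derD d)) der1 monalgU0 add0r scale1r.
exact: cmonom_derivX.
Qed.

Lemma dpoly_derivC d e f :
  dpoly_deriv d (dpoly_deriv e f) = dpoly_deriv e (dpoly_deriv d f).
Proof.
have cM d' := @cmonom_derivM Q _ (@dvar_deriv Delta n d').
apply: (malg_derivC (derD d) (derD e) (derM d) (derM e)
  (derC d e) (cM d) (cM e)).
elim/cmonom_ind => [|v|k l IHk IHl].
- have D1 d' : malg_deriv (der d') (cmonom_deriv Q (@dvar_deriv Delta n d'))
      << mone >> = 0.
    rewrite (malg_derivU (derD d')) der1 monalgU0 add0r scale1r.
    by rewrite /cmonom_deriv mdom1 big_seq_fset0.
  have D0 d' : malg_deriv (der d') (cmonom_deriv Q (@dvar_deriv Delta n d'))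
      0 = 0.
    by rewrite /malg_deriv msupp0 big_seq_fset0.
  by rewrite (D1 d) (D1 e) (D0 d) (D0 e).
- have X a b := etrans (congr1 (dpoly_deriv a) (dpoly_derivX b v))
    (dpoly_derivX a (dvar_deriv b v)).
  apply: etrans (X d e) (etrans _ (esym (X e d))).
  by rewrite /dvar_deriv incrC.
- have -> : << mmul k l >> = << k >> * << l >> :> P by rewrite malgUM mulr1.
  exact: (leibnizCM (dpoly_derivD d) (dpoly_derivM d) (dpoly_derivD e)
    (dpoly_derivM e) IHk IHl).
Qed.

HB.instance Definition _ :=
  ComNzRing_isDifferential.Build Delta (dpoly Q n)
    dpoly_derivD dpoly_derivM dpoly_derivC.

End DPoly.

Section Zeros.
Context (Delta : finType) (Q : diffRingType Delta) (n : nat).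

Definition deval (q : 'I_n -> Q) (f : dpoly Q n) : Q :=
  mmap idfun
    (fun m : {cmonom (dvar Delta n)} =>
       \prod_(v <- finsupp m) theta_act v.2 (q v.1) ^+ m v) f.

Definition zeros (E : set (dpoly Q n)) : set ('I_n -> Q) :=
  [set q | forall f, E f -> deval q f = 0].

Definition vanishing (X : set ('I_n -> Q)) : set (dpoly Q n) :=
  [set f | forall q, X q -> deval q f = 0].

End Zeros.

Definition diff_closed (Delta : finType) (Q : diffRingType Delta) : Prop :=
  forall n (a : set (dpoly Q n)), diff_ideal a ->
    diff_rad a = vanishing (zeros a).

(** * Hurwitz series *)

Section MultiIndex.
Context (Delta : finType).
Implicit Types (a g : Theta Delta).

Definition theta0 : Theta Delta := [ffun => 0%N].
Definition theta_le a g := [forall d, a d <= g d]%N.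
Definition theta_sub g a : Theta Delta := [ffun d => g d - a d]%N.
Definition theta_bin g a := (\prod_d 'C(g d, a d))%N.

Definition theta_below g : seq (Theta Delta) :=
  codom (fun a : {dffun forall d : Delta, 'I_(g d).+1} =>
    [ffun d => val (a d)]).

Lemma mem_theta_below g a : (a \in theta_below g) = theta_le a g.
Proof.
apply/codomP/forallP => [[b ->] d | le]; first by rewrite ffunE -ltnS ltn_ord.
exists [ffun d => Ordinal (le d : (a d < (g d).+1)%N)].
by apply/ffunP => d; rewrite !ffunE.
Qed.

Lemma theta_below_uniq g : uniq (theta_below g).
Proof.
rewrite map_inj_uniq ?enum_uniq // => a b /ffunP eqab.
by apply/ffunP => d; have := eqab d; rewrite !ffunE => /val_inj.
Qed.

Lemma theta_bin_nle g a : ~~ theta_le a g -> theta_bin g a = 0%N.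
Proof.
rewrite negb_forall => /existsP[d]; rewrite -ltnNge => lt.
by rewrite /theta_bin (bigD1 d) //= bin_small.
Qed.

Definition decr d a : Theta Delta := [ffun e => a e - (e == d)]%N.

Lemma theta_bin_incr d g a : theta_bin (incr d g) a =
  (theta_bin g a + (0 < a d) * theta_bin g (decr d a))%N.
Proof.
rewrite /theta_bin (bigD1 d) //= [in X in (X + _)%N](bigD1 d) //=.
rewrite [in X in (_ + X)%N](bigD1 d) //= !ffunE eqxx addn1 subn1.
rewrite [X in (_ * X)%N](_ : _ = \prod_(i | i != d) 'C(g i, a i))%N; last first.
  by apply: eq_bigr => e ne; rewrite ffunE (negbTE ne) addn0.
rewrite [X in (_ + _ * (_ * X))%N](_ : _ = \prod_(i | i != d) 'C(g i, a i))%N;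
  last first.
  by apply: eq_bigr => e ne; rewrite ffunE (negbTE ne) subn0.
case: (a d) => [|k] /=; first by rewrite !bin0 mul0n addn0.
by rewrite binS mulnDl mul1n.
Qed.

Lemma theta_ind (A : Theta Delta -> Prop) :
  A theta0 -> (forall d g, A g -> A (incr d g)) -> forall g, A g.
Proof.
move=> A0 AS g; have [k] := ubnP (\sum_d g d)%N; elim: k g => // k IH g lt.
have [/forallP g0 | ] := boolP [forall d, g d == 0%N].
  suff -> : g = theta0 by [].
  by apply/ffunP => d; rewrite ffunE; apply/eqP.
rewrite negb_forall => /existsP[d]; rewrite -lt0n => gd.
have -> : g = incr d (decr d g).
  by apply/ffunP => e; rewrite !ffunE subnK //; case: eqP => [->|].
apply/AS/IH; rewrite -ltnS; apply: leq_trans lt; rewrite ltnS (bigD1 d) //=.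
rewrite [in leqRHS](bigD1 d) //= -addSn leq_add //.
  by rewrite ffunE eqxx subn1 prednK.
by apply: leq_sum => e _; rewrite ffunE leq_subr.
Qed.

End MultiIndex.

Definition hurwitz (Delta : finType) (A : Type) : Type := Theta Delta -> A.

HB.instance Definition _ (Delta : finType) (A : comNzRingType) :=
  GRing.Zmodule.copy (hurwitz Delta A) (Theta Delta -> A).

Section Hurwitz.
Context (Delta : finType) (A : comNzRingType).
Local Notation H := (hurwitz Delta A).
Implicit Types (x y z : H) (g : Theta Delta) (d : Delta).

Definition hurwitz_one : H := fun g => (g == theta0 Delta)%:R.

Definition hurwitz_mul x y : H := fun g =>
  \sum_(a <- theta_below g) (theta_bin g a)%:R * x a * y (theta_sub g a).

Definition hurwitz_deriv d x : H := fun g => x (incr d g).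

Lemma hurwitzDE x y g : (x + y) g = x g + y g. Proof. by []. Qed.

Lemma hurwitz_mulDl x y z :
  hurwitz_mul (x + y) z = hurwitz_mul x z + hurwitz_mul y z.
Proof.
apply/funext => g; rewrite hurwitzDE /hurwitz_mul -big_split /=.
by apply: eq_bigr => a _; rewrite hurwitzDE mulrDr mulrDl.
Qed.

Lemma hurwitz_mulDr x y z :
  hurwitz_mul x (y + z) = hurwitz_mul x y + hurwitz_mul x z.
Proof.
apply/funext => g; rewrite hurwitzDE /hurwitz_mul -big_split /=.
by apply: eq_bigr => a _; rewrite hurwitzDE mulrDr.
Qed.

Lemma hurwitz_derivD d x y :
  hurwitz_deriv d (x + y) = hurwitz_deriv d x + hurwitz_deriv d y.
Proof. by []. Qed.

Lemma hurwitz_derivM d x y : hurwitz_deriv d (hurwitz_mul x y) =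
  hurwitz_mul (hurwitz_deriv d x) y + hurwitz_mul x (hurwitz_deriv d y).
Proof.
apply/funext => g; rewrite hurwitzDE /hurwitz_deriv /hurwitz_mul.
under eq_bigr do rewrite theta_bin_incr natrD 2!mulrDl natrM.
rewrite big_split /= addrC; congr (_ + _).
- rewrite (bigID (fun a : Theta Delta => 0 < a d)%N) /= [X in _ + X]big1 => [|a].
    rewrite addr0 -big_filter.
    rewrite (perm_big [seq incr d a | a <- theta_below g]); last first.
      have inj : injective (@incr Delta d).
        move=> a b /ffunP eqab; apply/ffunP => e.
        by have := eqab e; rewrite !ffunE => /addIn.
      apply: uniq_perm; rewrite ?filter_uniq ?(map_inj_uniq inj) //;
        try exact: theta_below_uniq.
      move=> a; rewrite mem_filter mem_theta_below; apply/andP/mapP.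
        move=> [a0 /forallP le]; exists (decr d a).
          rewrite mem_theta_below; apply/forallP => e.
          by rewrite ffunE leq_subLR addnC; have := le e; rewrite ffunE.
        apply/ffunP => e; rewrite !ffunE subnK //.
        by case: eqP => [->|].
      move=> [b]; rewrite mem_theta_below => /forallP le ->; split.
        by rewrite ffunE eqxx addn1.
      by apply/forallP => e; rewrite !ffunE leq_add2r.
    rewrite big_map; apply: eq_bigr => a _.
    have -> : decr d (incr d a) = a by apply/ffunP => e; rewrite !ffunE addnK.
    have -> : theta_sub (incr d g) (incr d a) = theta_sub g a.
      by apply/ffunP => e; rewrite !ffunE subnDr.
    by rewrite ffunE eqxx addn1 mul1r.
  by rewrite -leqNgt leqn0 => /eqP ->; rewrite !mul0r.
- rewrite (bigID (fun a => theta_le a g)) /= [X in _ + X]big1 => [|a nle].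
    rewrite addr0 -big_filter (perm_big (theta_below g)); last first.
      apply: uniq_perm; rewrite ?filter_uniq //; try exact: theta_below_uniq.
      move=> a; rewrite mem_filter !mem_theta_below andb_idr //.
      move=> /forallP le; apply/forallP => e.
      by rewrite ffunE (leq_trans (le e)) ?leq_addr.
    rewrite big_seq [RHS]big_seq; apply: eq_bigr => a.
    rewrite mem_theta_below => /forallP le; congr (_ * y _).
    by apply/ffunP => e; rewrite !ffunE addnBAC.
  by rewrite theta_bin_nle // !mul0r.
Qed.

Lemma hurwitz_mul0 x y :
  hurwitz_mul x y (theta0 Delta) = x (theta0 Delta) * y (theta0 Delta).
Proof.
rewrite /hurwitz_mul (perm_big [:: theta0 Delta]); last first.
  apply: uniq_perm => //; first exact: theta_below_uniq.
  move=> a; rewrite mem_theta_below inE; apply/forallP/eqP => [le | -> //].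
  by apply/ffunP => d; have := le d; rewrite !ffunE leqn0 => /eqP.
rewrite big_seq1 (_ : theta_sub _ _ = theta0 Delta); last first.
  by apply/ffunP => d; rewrite !ffunE.
by rewrite /theta_bin big1 ?mul1r // => d _; rewrite ffunE bin0.
Qed.

Lemma hurwitz_mulC : commutative hurwitz_mul.
Proof.
move=> x y; apply/funext => g; elim/theta_ind: g x y => [|d g IH] x y.
  by rewrite !hurwitz_mul0 mulrC.
rewrite -[LHS]/(hurwitz_deriv d _ g) -[RHS]/(hurwitz_deriv d _ g).
by rewrite !hurwitz_derivM !hurwitzDE IH [X in _ + X]IH addrC.
Qed.

Lemma hurwitz_mulA : associative hurwitz_mul.
Proof.
move=> x y z; apply/funext => g; elim/theta_ind: g x y z => [|d g IH] x y z.
  by rewrite !hurwitz_mul0 mulrA.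
rewrite -[LHS]/(hurwitz_deriv d _ g) -[RHS]/(hurwitz_deriv d _ g).
rewrite !hurwitz_derivM hurwitz_mulDl hurwitz_mulDr !hurwitzDE.
by rewrite !IH addrA.
Qed.

Lemma hurwitz_mul1 : left_id hurwitz_one hurwitz_mul.
Proof.
move=> x; apply/funext => g; elim/theta_ind: g x => [|d g IH] x.
  by rewrite hurwitz_mul0 /hurwitz_one eqxx mul1r.
rewrite -[LHS]/(hurwitz_deriv d _ g) hurwitz_derivM hurwitzDE IH.
suff -> : hurwitz_deriv d hurwitz_one = 0.
  rewrite [X in X + _](_ : _ = 0) ?add0r // /hurwitz_mul big1 // => a _.
  by rewrite mulr0 mul0r.
apply/funext => h; rewrite /hurwitz_deriv /hurwitz_one.
case: eqP => // /ffunP /(_ d); by rewrite !ffunE eqxx addn1.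
Qed.

Lemma hurwitz_one_neq0 : hurwitz_one != 0.
Proof.
apply/eqP => /(congr1 (fun x : H => x (theta0 Delta))).
by rewrite /hurwitz_one eqxx => /eqP; rewrite oner_eq0.
Qed.

HB.instance Definition _ := GRing.Zmodule_isComNzRing.Build H
  hurwitz_mulA hurwitz_mulC hurwitz_mul1 hurwitz_mulDl hurwitz_one_neq0.

Lemma hurwitz_derivC d e x :
  hurwitz_deriv d (hurwitz_deriv e x) = hurwitz_deriv e (hurwitz_deriv d x).
Proof. by apply/funext => g; rewrite /hurwitz_deriv incrC. Qed.

HB.instance Definition _ := ComNzRing_isDifferential.Build Delta H
  hurwitz_derivD hurwitz_derivM hurwitz_derivC.

End Hurwitz.

(* Main.v *)
Require Import Defs.
From HB Require Import structures.
From mathcomp Require Import all_boot all_order all_algebra all_field.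
From mathcomp Require Import finmap.
From mathcomp Require Import boolp classical_sets functions cardinality.
From mathcomp.multinomials Require Import monalg.

Set Implicit Arguments.
Unset Strict Implicit.
Unset Printing Implicit Defensive.

Import GRing.Theory.

Local Open Scope quotient_scope.
Local Open Scope classical_set_scope.
Local Open Scope ring_scope.

(** In characteristic p all p-th powers are constants, so each element of a
   quasifield is a unit or has p-th power 0. A ring morphism f from a
   differential ring to A extends to a differential morphism
   x |-> (f (theta x))_theta to H A, which is injective on quasifields. For a
   field F, a differential subring of H F is a quasifield as soon as its
   constant terms form a field.

   Hence if Q, with residue field K, has no proper simple extension, then, for
   an extension F of K, an element h of H F lies in Q whenever the ring
   generated over K by the coefficients of h is a field. With F = K this gives
   Q = H K; with F algebraic, K is algebraically closed; if K were countable,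
   the coefficients of some h would exhaust F = K(t).

   Conversely, if K is uncountable and algebraically closed, a countably
   generated K-algebra satisfies the Nullstellensatz over K; a K-point of an
   extension of H K extends to a differential retraction onto H K, and this
   settles both countably generated quasifields and differential
   polynomials. *)

(** * Differential rings and quasifields *)

Section DiffRings.
Context (Delta : finType) (R : diffRingType Delta).
Implicit Types (x y : R) (d : Delta) (g : Theta Delta).

Lemma derN d x : der d (- x) = - der d x.
Proof. by apply/eqP; rewrite -addr_eq0 -derD addNr der0. Qed.

Lemma derMn d x n : der d (x *+ n) = der d x *+ n.
Proof. by elim: n => [|n IH]; rewrite ?mulr0n ?der0 // !mulrS derD IH. Qed.

Lemma derX d x n : der d (x ^+ n.+1) = (x ^+ n * der d x) *+ n.+1.
Proof.
elim: n => [|n IH]; first by rewrite expr1 mul1r.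
rewrite exprS derM IH -mulrnAr mulrA -exprS.
by rewrite [der d x * _]mulrC [RHS]mulrS mulrnAr.
Qed.

Lemma der_iterC d e n x : der d (iter n (der e) x) = iter n (der e) (der d x).
Proof. by elim: n => //= n IH; rewrite derC IH. Qed.

Lemma theta_act0 x : theta_act (theta0 Delta) x = x.
Proof.
by rewrite /theta_act; elim: (enum Delta) => //= d s ->; rewrite ffunE.
Qed.

Lemma der_theta_act d g x : der d (theta_act g x) = theta_act g (der d x).
Proof.
by rewrite /theta_act; elim: (enum Delta) => //= e s <-; rewrite der_iterC.
Qed.

(** [d] occurs exactly once in [enum Delta], and since derivations commute, the extra factor can be
    carried to that place. *)
Lemma theta_act_incr d g x : theta_act (incr d g) x = theta_act g (der d x).
Proof.
rewrite -der_theta_act /theta_act.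
have: d \in enum Delta by rewrite mem_enum.
elim: (enum Delta) (enum_uniq Delta) => //= e s IH /andP[es us].
rewrite inE ffunE eq_sym; have [ed|ne] := eqVneq e d.
  rewrite ed in es *.
  rewrite addn1 iterS => _; congr (der _ (iter _ _ _)).
  elim: s es {us IH} => //= c s IH; rewrite inE negb_or => /andP[ne /IH ->].
  by rewrite ffunE eq_sym (negbTE ne) addn0.
by rewrite addn0 /= => ds; rewrite IH // der_iterC.
Qed.

Lemma diff_ideal_theta (a : set R) g x :
  diff_ideal a -> a x -> a (theta_act g x).
Proof.
move=> ida; elim/theta_ind: g x => [|d g IH] x ax; first by rewrite theta_act0.
by rewrite theta_act_incr; apply/IH/(diff_ideal_deriv ida).
Qed.

(** This set is the largest differential ideal inside the ideal [T]. Its stability under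
    multiplication is the Leibniz rule, applied one derivation at a time. *)
Lemma diff_ideal_theta_preim (T : set R) :
  T 0 -> (forall x y, T x -> T y -> T (x + y)) ->
  (forall x y, T x -> T (y * x)) ->
  diff_ideal [set x : R | forall g, T (theta_act g x)].
Proof.
move=> T0 TD TM; have S0 g : theta_act g (0 : R) = 0.
  by elim/theta_ind: g => [|d g IH]; rewrite ?theta_act0 // theta_act_incr der0.
have SD g x y : theta_act g (x + y) = theta_act g x + theta_act g y.
  elim/theta_ind: g x y => [|d g IH] x y; first by rewrite !theta_act0.
  by rewrite !theta_act_incr derD.
split => [g|x y Tx Ty g|r x Tx g|d x Tx g]; first by rewrite S0.
- by rewrite SD; apply: TD.
- elim/theta_ind: g r x Tx => [|d g IH] r x Tx.
    by rewrite theta_act0; apply: TM; have := Tx (theta0 _); rewrite theta_act0.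
  rewrite theta_act_incr derM SD; apply: TD; apply: IH => // h.
  by rewrite -theta_act_incr.
- by rewrite -theta_act_incr.
Qed.

Section PChar.
Context (p : nat) (pR : p \in [pchar R]).

Lemma der_pchar d x : der d (x ^+ p) = 0.
Proof.
have /prime_gt0 := pcharf_prime pR; case: p pR => // n nR _.
by rewrite derX -mulr_natl pcharf0 // mul0r.
Qed.

Lemma theta_act_pchar g x : g != theta0 Delta -> theta_act g (x ^+ p) = 0.
Proof.
elim/theta_ind: g => [|d g _ _]; first by rewrite eqxx.
rewrite theta_act_incr der_pchar; elim/theta_ind: g => [|e g IH].
  by rewrite theta_act0.
by rewrite theta_act_incr der0.
Qed.

Lemma expr_pcharD x y : (x + y) ^+ p = x ^+ p + y ^+ p.
Proof. by rewrite -!(pFrobenius_autE pR) rmorphD. Qed.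

End PChar.

Section Quasifields.
Hypothesis Rq : quasifield R.

Lemma quasifield_ideal (a : set R) x : diff_ideal a -> ~ a 1 -> a x -> x = 0.
Proof. by move=> /(quasifield_simple Rq)[->|->]. Qed.

(** Descent on an integer [m] that vanishes in [R]: a prime factor [q] of [m] generates a
    differential ideal, so either [q] vanishes in [R], or it is invertible and [m %/ q] vanishes. *)
Lemma quasifield_pchar : {p | p \in [pchar R]}.
Proof.
apply: cid; have [n n0 nR] := quasifield_char Rq.
suff H : forall m, (m <= n)%N -> (0 < m)%N -> m%:R = 0 :> R ->
    exists p, p \in [pchar R] by apply: (H n).
elim/ltn_ind => m IH mn m0 mR.
have m1 : (1 < m)%N.
  by case: m m0 mR {IH mn} => [|[|m]] // _ /eqP; rewrite oner_eq0.
pose q := pdiv m; have qm : (q %| m)%N := pdiv_dvd m.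
have [q0|nq0] := pselect (q%:R = 0 :> R).
  by exists q; rewrite inE /= q0 eqxx pdiv_prime.
have ida : diff_ideal [set x : R | exists y, x = q%:R * y].
  split; first by exists 0; rewrite mulr0.
  - by move=> _ _ [u ->] [v ->]; exists (u + v); rewrite mulrDr.
  - by move=> r _ [u ->]; exists (r * u); rewrite mulrCA.
  - move=> d _ [u ->]; exists (der d u).
    by rewrite !mulr_natl derMn.
have [/= a1|a1] := pselect ((exists y, 1 = q%:R * y :> R)); last first.
  by case: nq0; apply: (quasifield_ideal ida a1); exists 1; rewrite mulr1.
have lt : (m %/ q < m)%N by rewrite ltn_Pdiv // prime_gt1 // pdiv_prime.
apply: (IH _ lt) => //; first exact: leq_trans (ltnW lt) mn.
  by rewrite divn_gt0 ?pdiv_gt0 // dvdn_leq.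
have [y y1] := a1.
rewrite -[LHS]mulr1 [X in _ * X = _]y1 mulrA -natrM divnK //.
by rewrite mR mul0r.
Qed.

(** As [x ^+ p] is killed by all derivations, its multiples form a differential ideal, which is 0 or
    contains 1. *)
Lemma quasifield_unit_or_nil x p : p \in [pchar R] ->
  x ^+ p = 0 \/ exists y, x * y = 1.
Proof.
move=> pR; have /prime_gt0 p0 := pcharf_prime pR.
have ida : diff_ideal [set z : R | exists y, z = x ^+ p * y].
  split; first by exists 0; rewrite mulr0.
  - by move=> _ _ [u ->] [v ->]; exists (u + v); rewrite mulrDr.
  - by move=> r _ [u ->]; exists (r * u); rewrite mulrCA.
  - move=> d _ [u ->]; exists (der d u).
    by rewrite derM der_pchar // mul0r add0r.
have [/= [y y1]|a1] := pselect ((exists y, 1 = x ^+ p * y)); last first.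
  by left; apply: (quasifield_ideal ida a1); exists 1; rewrite mulr1.
by right; exists (x ^+ p.-1 * y); rewrite mulrA -exprS prednK.
Qed.

(* The elements all of whose derivatives are nilpotent form a differential
   ideal. *)
Lemma quasifield_theta_nil x :
  (forall g, exists k, theta_act g x ^+ k = 0) -> x = 0.
Proof.
have [p pR] := quasifield_pchar; have p0 := prime_gt0 (pcharf_prime pR).
(* A nilpotent element is no unit, so its p-th power is 0. With this fixed exponent, additivity is
   that of the Frobenius map. *)
have nilp y k : y ^+ k = 0 -> y ^+ p = 0.
  have [//|[z yz] yk] := quasifield_unit_or_nil y pR.
  have /eqP := congr1 (fun t => t ^+ k) yz.
  by rewrite exprMn yk mul0r expr1n eq_sym oner_eq0.
move=> nx; pose T := [set y : R | y ^+ p = 0].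
apply: (@quasifield_ideal [set y : R | forall g, T (theta_act g y)]).
- apply: diff_ideal_theta_preim => [|y z y0 z0|y z y0] /=.
  + by rewrite /T /= expr0n gtn_eqF.
  + by rewrite /T /= expr_pcharD // y0 z0 addr0.
  + by rewrite /T /= exprMn y0 mulr0.
- move=> /(_ (theta0 _)); rewrite /T /= theta_act0 expr1n.
  by move/eqP; rewrite oner_eq0.
- by move=> g /=; have [k] := nx g; apply: nilp.
Qed.

End Quasifields.
End DiffRings.

Section DiffMorphisms.
Context (Delta : finType).

Lemma morph_theta_act (R S : diffRingType Delta) (f : R -> S) g x :
  (forall d x, f (der d x) = der d (f x)) ->
  f (theta_act g x) = theta_act g (f x).
Proof.
move=> fd; elim/theta_ind: g x => [|d g IH] x; first by rewrite !theta_act0.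
by rewrite !theta_act_incr IH fd.
Qed.

Lemma quasifield_inj (R S : diffRingType Delta) (f : {rmorphism R -> S}) :
  quasifield R -> (forall d x, f (der d x) = der d (f x)) -> injective f.
Proof.
move=> Rq fd; apply: raddf_inj => x fx.
apply: (@quasifield_ideal _ _ Rq [set y | f y = 0]) => /=.
- split => [|y z|r y|d y] /=; rewrite ?raddf0 // ?rmorphD ?rmorphM ?fd.
  + by move=> -> ->; rewrite addr0.
  + by move=> ->; rewrite mulr0.
  + by move=> ->; rewrite der0.
- by rewrite rmorph1 => /eqP; rewrite oner_eq0.
- by [].
Qed.

(* A nonzero differential ideal contains a multiple of some derivative with
   value 1 under [f], and its p-th power is 1. *)
Lemma quasifieldP (R : diffRingType Delta) (F : fieldType)
    (f : {rmorphism R -> F}) p : p \in [pchar R] ->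
    (forall x, (forall g, f (theta_act g x) = 0) -> x = 0) ->
    (forall x, f x != 0 -> exists y, f (x * y) = 1) ->
  quasifield R.
Proof.
move=> pR f0 fV; have p0 := prime_gt0 (pcharf_prime pR); split.
  by exists p => //; apply: pcharf0.
move=> a ida; have [a1|na1] := pselect (a 1).
  right; apply/seteqP; split => // x _.
  by rewrite -[x]mulr1; apply: (diff_idealM ida).
left; apply/seteqP; split => [x ax|_ ->]; last exact: (diff_ideal0 ida).
apply: (f0) => g; apply/eqP/negPn/negP => nz.
have [y /eqP fy] := fV _ nz; apply: na1; set z := theta_act g x * y in fy.
have az : a z.
  by rewrite /z mulrC; apply: (diff_idealM ida); apply: diff_ideal_theta.
(* [z - 1] has value 0 under [f], and all proper derivatives of a p-th power vanish, so [f] kills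
   every derivative of [(z - 1) ^+ p]. *)
suff w0 : (z - 1) ^+ p = 0.
  have <- : z ^+ p = 1.
    by rewrite -[z](subrK 1) expr_pcharD // w0 add0r expr1n.
  by rewrite -(prednK p0) exprSr; apply: (diff_idealM ida).
apply: f0 => h; have [->|nh] := eqVneq h (theta0 Delta).
  by rewrite theta_act0 rmorphXn rmorphB (eqP fy) rmorph1 subrr expr0n gtn_eqF.
by rewrite theta_act_pchar // rmorph0.
Qed.

End DiffMorphisms.

(** * Hurwitz series and Taylor morphisms *)

Section HurwitzTheory.
Context (Delta : finType) (A : comNzRingType).
Local Notation H := (hurwitz Delta A).
Implicit Types (x y : H) (g : Theta Delta) (d : Delta).

Lemma hurwitz_theta_act g x : theta_act g x (theta0 Delta) = x g.
Proof.
elim/theta_ind: g x => [|d g IH] x; first by rewrite theta_act0.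
by rewrite theta_act_incr IH.
Qed.

Definition hurwitz_ev0 x : A := x (theta0 Delta).

Lemma hurwitz_ev0_is_zmod_morphism : zmod_morphism hurwitz_ev0.
Proof. by []. Qed.

Lemma hurwitz_ev0_is_monoid_morphism : monoid_morphism hurwitz_ev0.
Proof. split=> [|x y]; last exact: hurwitz_mul0.
by rewrite -[LHS]/(@hurwitz_one Delta A (theta0 Delta)) /hurwitz_one eqxx. Qed.

HB.instance Definition _ := GRing.isZmodMorphism.Build H A hurwitz_ev0
  hurwitz_ev0_is_zmod_morphism.
HB.instance Definition _ := GRing.isMonoidMorphism.Build H A hurwitz_ev0
  hurwitz_ev0_is_monoid_morphism.

Definition hurwitz_const (c : A) : H :=
  fun g => if g == theta0 Delta then c else 0.

Lemma hurwitz_derP x y : x (theta0 Delta) = y (theta0 Delta) ->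
  (forall d, der d x = der d y) -> x = y.
Proof.
move=> e0 ed; apply/funext; elim/theta_ind => // d g _.
exact: (congr1 (fun z : H => z g) (ed d)).
Qed.

Lemma der_hurwitz_const d c : der d (hurwitz_const c) = 0.
Proof.
apply/funext => g; rewrite /der /= /hurwitz_deriv /hurwitz_const.
by case: eqP => // /ffunP /(_ d); rewrite !ffunE eqxx addn1.
Qed.

Lemma hurwitz_const0 c : hurwitz_const c (theta0 Delta) = c.
Proof. by rewrite /hurwitz_const eqxx. Qed.

Lemma hurwitz_const_is_zmod_morphism : zmod_morphism hurwitz_const.
Proof.
move=> a b; apply: hurwitz_derP => [|d].
  rewrite -[RHS]/(hurwitz_ev0 (hurwitz_const a - hurwitz_const b)) rmorphB.
  by rewrite /= /hurwitz_ev0 !hurwitz_const0.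
by rewrite derD derN !der_hurwitz_const subrr.
Qed.

Lemma hurwitz_const_is_monoid_morphism : monoid_morphism hurwitz_const.
Proof.
split=> [|a b]; apply: hurwitz_derP => [|d].
- by rewrite hurwitz_const0 -[RHS]/(hurwitz_ev0 1) rmorph1.
- by rewrite der_hurwitz_const der1.
- by rewrite [RHS]hurwitz_mul0 !hurwitz_const0.
- by rewrite derM !der_hurwitz_const mul0r mulr0 addr0.
Qed.

HB.instance Definition _ := GRing.isZmodMorphism.Build A H hurwitz_const
  hurwitz_const_is_zmod_morphism.
HB.instance Definition _ := GRing.isMonoidMorphism.Build A H hurwitz_const
  hurwitz_const_is_monoid_morphism.

Section Taylor.
Context (R : diffRingType Delta) (f : {rmorphism R -> A}).

Definition taylor (x : R) : H := fun g => f (theta_act g x).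

Lemma taylor_der d (x : R) : taylor (der d x) = der d (taylor x).
Proof. by apply/funext => g; rewrite /taylor -theta_act_incr. Qed.

Lemma taylor0E (x : R) : taylor x (theta0 Delta) = f x.
Proof. by rewrite /taylor theta_act0. Qed.

Lemma taylor_is_zmod_morphism : zmod_morphism taylor.
Proof.
move=> x y; apply/funext => g; rewrite -[RHS]/(taylor x g - taylor y g).
elim/theta_ind: g x y => [|d g IH] x y; first by rewrite !taylor0E rmorphB.
by have := IH (der d x) (der d y); rewrite /taylor !theta_act_incr derD derN.
Qed.

HB.instance Definition _ := GRing.isZmodMorphism.Build R H taylor
  taylor_is_zmod_morphism.

Lemma taylor_is_monoid_morphism : monoid_morphism taylor.
Proof.
split=> [|x y].
  apply: hurwitz_derP => [|d].
    by rewrite taylor0E -[RHS]/(hurwitz_ev0 1) !rmorph1.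
  by rewrite -taylor_der !der1 raddf0.
(* Coefficient [incr d g] of a product is coefficient [g] of its derivative. The Leibniz rule leads
   to products of other elements, hence an induction over all [x] and [y]. *)
apply/funext => g; elim/theta_ind: g x y => [|d g IH] x y.
  by rewrite [RHS]hurwitz_mul0 !taylor0E rmorphM.
have incrE (z : H) : z (incr d g) = der d z g by [].
by rewrite !incrE derM -!taylor_der derM raddfD !hurwitzDE /= !IH.
Qed.

HB.instance Definition _ := GRing.isMonoidMorphism.Build R H taylor
  taylor_is_monoid_morphism.

End Taylor.
End HurwitzTheory.

(** * Subrings, the residue field and differential subrings *)

Section Subrings.
Context (R : comNzRingType) (B : {pred R}).

(** The closure proof is an argument, so that the ring structure can be inferred for a predicate
    built inside a proof. *)
Definition subring_pred & GRing.subring_closed B := B.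
Context (cB : GRing.subring_closed B).

HB.instance Definition _ :=
  GRing.isSubringClosed.Build R (subring_pred cB) cB.

Definition subring_type := {x : R | x \in subring_pred cB}.

HB.instance Definition _ := [Choice of subring_type by <:].
HB.instance Definition _ := [isSub of subring_type for @sval _ _].
HB.instance Definition _ := [SubChoice_isSubComNzRing of subring_type by <:].

End Subrings.

(* The maximal ideal of a quasifield being the kernel of the Frobenius
   endomorphism, the residue field is realized as the ring of p-th powers. *)
Lemma residue_field (Delta : finType) (Q : diffRingType Delta) :
  quasifield Q ->
  {K : fieldType & {f : {rmorphism Q -> K} | forall c, exists x, f x = c}}.
Proof.
move=> Qq; have [p pQ] := quasifield_pchar Qq.
pose B : {pred Q} := [pred x | `[< exists y, x = y ^+ p >]].
have cB : GRing.subring_closed B.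
  split.
  - by apply/asboolP; exists 1; rewrite expr1n.
  - move=> _ _ /asboolP[u ->] /asboolP[v ->]; apply/asboolP; exists (u - v).
    by rewrite -!(pFrobenius_autE pQ) rmorphB.
  - move=> _ _ /asboolP[u ->] /asboolP[v ->]; apply/asboolP; exists (u * v).
    by rewrite exprMn.
pose K0 := subring_type cB.
(* The inverse of [y ^+ p] is [z ^+ p] for an inverse [z] of [y]. The last clause fixes the value 0
   at 0, which the field structure demands. *)
have Vex (c : K0) : exists b : K0, (c != 0 -> b * c = 1) /\ (c = 0 -> b = 0).
  have [->|nc] := eqVneq c 0; first by exists 0.
  have /asboolP[y cy] := valP c.
  have [y0|[z yz]] := quasifield_unit_or_nil Qq y pQ.
    by case/eqP: nc; apply: val_inj; rewrite /= -y0 -cy.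
  have Bz : z ^+ p \in B by apply/asboolP; exists z.
  exists (Sub (z ^+ p) Bz : K0); split => [_|/eqP]; last by rewrite (negbTE nc).
  by apply: val_inj; rewrite /= -[sval c]/(val c) cy -exprMn mulrC yz expr1n.
pose inv c := projT1 (cid (Vex c)).
have mulVf c : c != 0 -> inv c * c = 1 by case: (projT2 (cid (Vex c))).
have inv0 : inv 0 = 0 by case: (projT2 (cid (Vex 0))) => _ /(_ erefl).
pose Kf := GRing.ComNzRing_isField.Build K0 mulVf inv0.
pose K : fieldType := HB.pack K0 Kf.
have Bp x : x ^+ p \in B by apply/asboolP; exists x.
pose f x : K := Sub (x ^+ p) (Bp x) : K0.
have fB : zmod_morphism f.
  move=> x y; apply: val_inj => /=.
  by rewrite -!(pFrobenius_autE pQ) rmorphB.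
have fM : monoid_morphism f.
  by split=> [|x y]; apply: val_inj; rewrite /= ?expr1n ?exprMn.
pose F1 := GRing.isZmodMorphism.Build Q K f fB.
pose F2 := GRing.isMonoidMorphism.Build Q K f fM.
pose F : {rmorphism Q -> K} := HB.pack f F1 F2.
exists K, F => c.
by have /asboolP[y cy] := valP (c : K0); exists y; apply: val_inj.
Qed.

Lemma diff_subring (Delta : finType) (R : diffRingType Delta) (B : {pred R}) :
  GRing.subring_closed B -> (forall d x, x \in B -> der d x \in B) ->
  {L : diffRingType Delta & {j : {rmorphism L -> R} |
    [/\ injective j, forall d x, j (der d x) = der d (j x),
        forall x, j x \in B & forall x, x \in B -> exists y, j y = x]}}.
Proof.
move=> cB dB; pose L0 := subring_type cB.
pose D d (x : L0) : L0 := Sub (der d (val x)) (dB d _ (valP x)).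
have DD d : {morph D d : x y / x + y}.
  by move=> x y; apply: val_inj; rewrite /= derD.
have DM d x y : D d (x * y) = D d x * y + x * D d y.
  by apply: val_inj; rewrite /= derM.
have DC d e x : D d (D e x) = D e (D d x) by apply: val_inj; rewrite /= derC.
pose Lm := ComNzRing_isDifferential.Build Delta L0 DD DM DC.
pose L : diffRingType Delta := HB.pack L0 Lm.
exists L, (val : {rmorphism L0 -> R}); split => //.
- by move=> x; apply: (valP (x : L0)).
- by move=> x xB; exists (Sub x xB : L0).
Qed.

(** * The Nullstellensatz over an uncountable field *)

Section Ideals.
Context (R : comNzRingType).
Implicit Types (a M : set R) (g x y : R).

Record ideal_set a : Prop := IdealSet {
  ideal_set0 : a 0;
  ideal_setD : forall x y, a x -> a y -> a (x + y);
  ideal_setM : forall r x, a x -> a (r * x)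
}.

Lemma ideal_setB a x y : ideal_set a -> a x -> a y -> a (x - y).
Proof.
move=> ida ax ay; apply: (ideal_setD ida) => //.
by rewrite -mulN1r; apply: (ideal_setM ida).
Qed.

Lemma ideal_set_sum a (I : Type) (r : seq I) (F : I -> R) : ideal_set a ->
  (forall i, a (F i)) -> a (\sum_(i <- r) F i).
Proof.
move=> ida aF; apply: (big_ind a) => //; first exact: (ideal_set0 ida).
exact: (ideal_setD ida).
Qed.

(** Such an [M] corresponds to a maximal ideal of the localization R[1/g], which is never formed; by
    the last clause, every [x] outside [M] is invertible there modulo [M]. *)
Record maximal_avoiding g M : Prop := MaximalAvoiding {
  avoiding_ideal : ideal_set M;
  avoiding_expr : forall k, ~ M (g ^+ k);
  avoiding_max : forall x, ~ M x -> exists k y, M (g ^+ k - x * y)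
}.

Arguments avoiding_expr {g M}.

Lemma maximal_avoiding_ex a g : ideal_set a -> (forall k, ~ a (g ^+ k)) ->
  exists2 M, maximal_avoiding g M & a `<=` M.
Proof.
move=> ida ag.
(* Zorn's lemma is applied to unions with [a], so that the empty chain causes no exception. *)
pose P (X : set R) := ideal_set (a `|` X) /\ forall k, ~ (a `|` X) (g ^+ k).
have [|A [[idM Mg] maxA]] := @Zorn_bigcup _ P.
  move=> F FP Ftot; have [[X0 FX0]|nF] := pselect (exists X, F X); last first.
    have -> : \bigcup_(X in F) X = set0.
      by apply/seteqP; split => // x [X FX _]; case: nF; exists X.
    by rewrite /P setU0.
  have cover x : (a `|` \bigcup_(X in F) X) x -> exists2 X, F X & (a `|` X) x.
    by case=> [ax|[X FX Xx]]; [exists X0 => //; left | exists X => //; right].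
  have sub X x : F X -> (a `|` X) x -> (a `|` \bigcup_(X in F) X) x.
    by move=> FX [ax|Xx]; [left | right; exists X].
  split; last by move=> k /cover [X /FP[_ /(_ k)]].
  split; first by left; apply: (ideal_set0 ida).
  - move=> x y /cover[X FX Xx] /cover[Y FY Yy].
    have mono U V : U `<=` V -> a `|` U `<=` a `|` V.
      by move=> UV z [az|Uz]; [left | right; apply: UV].
    have [XY|YX] := Ftot _ _ FX FY.
      apply: (sub Y) => //; have [idY _] := FP _ FY.
      by apply: (ideal_setD idY) => //; apply: mono Xx.
    apply: (sub X) => //; have [idX _] := FP _ FX.
    by apply: (ideal_setD idX) => //; apply: mono Yy.
  - move=> r x /cover[X FX Xx]; apply: (sub X) => //.
    by have [idX _] := FP _ FX; apply: (ideal_setM idX).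
exists (a `|` A); last by move=> x; left.
split => // x nMx; set M := a `|` A.
(* [N] is the ideal M + xR. If it contained no power of [g], maximality would force [x] into [M]. *)
pose N := [set z | exists u y, M u /\ z = u + x * y].
have idN : ideal_set N.
  split; first exists 0, 0.
  - by rewrite mulr0 addr0; split => //; apply: (ideal_set0 idM).
  - move=> _ _ [u [y [Mu ->]]] [v [z [Mv ->]]]; exists (u + v), (y + z).
    by split; [apply: (ideal_setD idM) | rewrite mulrDr addrACA].
  - move=> r _ [u [y [Mu ->]]]; exists (r * u), (r * y).
    by split; [apply: (ideal_setM idM) | rewrite mulrDr mulrCA].
have MN : M `<=` N by move=> u Mu; exists u, 0; rewrite mulr0 addr0.
have [[k [u [y [Mu gE]]]]|nN] := pselect (exists k, N (g ^+ k)).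
  by exists k, y; rewrite gE addrK.
have aN : a `|` N = N by apply/setUidPr => z az; apply: MN; left.
case: (maxA N); last first.
  by split; rewrite aN // => k Nk; apply: nN; exists k.
split; first by move=> z Az; apply: MN; right.
move=> NA; apply: nMx; right; apply: NA; exists 0, 1.
by rewrite mulr1 add0r; split => //; apply: (ideal_set0 idM).
Qed.

(** If neither factor were in [M], then modulo [M] some powers of [g] would be multiples of [x] and
    of [y], and their product a multiple of [x * y]. *)
Lemma maximal_avoiding_prime g M x y :
  maximal_avoiding g M -> M (x * y) -> M x \/ M y.
Proof.
case=> idM Mg Mmax Mxy; apply: contrapT.
move=> /not_orP[/Mmax[k [u Mu]] /Mmax[l [v Mv]]].
apply: (Mg (k + l)%N); rewrite exprD.
have -> : g ^+ k * g ^+ l = g ^+ l * (g ^+ k - x * u) +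
    (x * u) * (g ^+ l - y * v) + (u * v) * (x * y).
  rewrite !mulrBr [g ^+ l * _]mulrC [g ^+ l * (x * u)]mulrC subrKA.
  by rewrite mulrACA [x * y * _]mulrC subrK.
by do ![apply: (ideal_setD idM)]; apply: (ideal_setM idM).
Qed.

Lemma maximal_avoiding_radical g M x k :
  maximal_avoiding g M -> M (x ^+ k) -> M x.
Proof.
move=> gM; elim: k => [|k IH].
  by have := avoiding_expr gM 0; rewrite !expr0.
by rewrite exprS => /(maximal_avoiding_prime gM)[|/IH].
Qed.

End Ideals.

Arguments avoiding_expr {R g M}.

(** Otherwise [T] would be a countable union of finite sets. *)
Lemma uncountable_infinite_fiber (T : choiceType) (C : countType) (f : T -> C) :
  ~ countable [set: T] -> exists c, infinite_set (f @^-1` [set c]).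
Proof.
move=> nT; apply: contrapT => nf; apply: nT.
have -> : [set: T] = \bigcup_(c in [set: C]) (f @^-1` [set c]).
  by apply/seteqP; split => // x _; exists (f x).
apply: bigcup_countable; first exact: countableP.
move=> c _; apply: finite_set_countable; apply: contrapT => inf.
by apply: nf; exists c.
Qed.

Section Nullstellensatz.
Context (K : closedFieldType) (R : comNzRingType) (k : {rmorphism K -> R}).
Context (s : nat -> R).
Hypothesis uncountableK : ~ countable [set: K].
Hypothesis generated : forall B : {pred R}, GRing.subring_closed B ->
  (forall c, k c \in B) -> (forall x n, x ^+ n = 0 -> x \in B) ->
  (forall i, s i \in B) -> forall x, x \in B.
Context (g : R) (M : set R) (gM : maximal_avoiding g M).

Let idM := avoiding_ideal gM.
Let mon (w : seq nat) := \prod_(i <- w) s i.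
Let lin (l : seq (K * seq nat)) := \sum_(t <- l) k t.1 * mon t.2.

Lemma span_avoiding x : exists l, M (x - lin l).
Proof.
pose B : {pred R} := [pred x | `[< exists l, M (x - lin l) >]].
have M0 := ideal_set0 idM.
suff /asboolP : x \in B by [].
apply: generated => [|c|y n yn|i].
- split.
  + apply/asboolP; exists [:: (1, [::])].
    by rewrite /lin big_seq1 /mon big_nil rmorph1 mulr1 subrr.
  + move=> u v /asboolP[l Ml] /asboolP[m Mm]; apply/asboolP.
    exists (l ++ [seq (- t.1, t.2) | t <- m]).
    rewrite /lin big_cat big_map /=.
    under [X in _ - (_ + X)]eq_bigr do rewrite rmorphN mulNr.
    by rewrite sumrN opprD addrACA -opprD; apply: ideal_setB.
  + move=> u v /asboolP[l Ml] /asboolP[m Mm]; apply/asboolP.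
    exists [seq (t.1 * t'.1, t.2 ++ t'.2) | t <- l, t' <- m].
    have -> : lin [seq (t.1 * t'.1, t.2 ++ t'.2) | t <- l, t' <- m] =
        lin l * lin m.
      rewrite /lin big_allpairs_dep big_distrl /=; apply: eq_bigr => t _.
      rewrite big_distrr /=; apply: eq_bigr => t' _.
      by rewrite rmorphM /mon big_cat /= mulrACA.
    have -> : u * v - lin l * lin m = v * (u - lin l) + lin l * (v - lin m).
      by rewrite !mulrBr [v * u]mulrC [v * _]mulrC subrKA.
    by apply: (ideal_setD idM); apply: (ideal_setM idM).
- apply/asboolP; exists [:: (c, [::])].
  by rewrite /lin big_seq1 /mon big_nil mulr1 subrr.
- apply/asboolP; exists [::]; rewrite /lin big_nil subr0.
  by apply: (maximal_avoiding_radical gM (k := n)); rewrite yn.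
- apply/asboolP; exists [:: (1, [:: i])].
  by rewrite /lin big_seq1 /mon big_seq1 rmorph1 mul1r subrr.
Qed.

Let const_avoiding c : M (k c) -> c = 0.
Proof.
move=> Mc; apply/eqP/negPn/negP => nc; apply: (avoiding_expr gM 0).
by rewrite expr0 -(rmorph1 k) -(mulVf nc) rmorphM; apply: (ideal_setM idM).
Qed.

(* The elements g^e / (x - c) of R[1/g]/M, with c in K, would be uncountably
   many; infinitely many of them lie in one finite-dimensional subspace, and a
   linear relation between them is an algebraic equation for x. *)
Lemma residue_avoiding x : exists c, M (x - k c).
Proof.
apply: contrapT => nx.
have xc c : exists t : nat * R * seq (K * seq nat),
    M (g ^+ t.1.1 - (x - k c) * t.1.2) /\ M (t.1.2 - lin t.2).
  have [|e [y My]] := avoiding_max gM (x := x - k c).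
    by move=> Mc; apply: nx; exists c.
  by have [l Ml] := span_avoiding y; exists (e, y, l).
pose F c := projT1 (cid (xc c)).
have FP c := projT2 (cid (xc c)); rewrite -/(F _) in FP.
(* Exponents and lists of words form a countable type, so infinitely many [c] share the same [e] and
   [w]. One more of them is taken than there are words, so that the matrix [A] below has a nonzero
   left kernel. *)
have [[e w]] := uncountable_infinite_fiber
  (fun c => ((F c).1.1, map snd (F c).2)) uncountableK.
move=> /(infinite_set_fset (size w).+1)[S Sw Scard].
pose m := size w; pose c (i : 'I_m.+1) := nth 0 S i.
have cS i : c i \in S by rewrite mem_nth // (leq_trans (ltn_ord i)).
have Fe i : (F (c i)).1.1 = e by have [] := Sw _ (cS i).
have Fw i : map snd (F (c i)).2 = w by have [] := Sw _ (cS i).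
have cinj : injective c.
  move=> i j /eqP; rewrite nth_uniq ?fset_uniq ?(leq_trans (ltn_ord _)) //.
  by move=> /eqP /val_inj.
pose y i := (F (c i)).1.2.
have My i : M (g ^+ e - (x - k (c i)) * y i).
  by rewrite -(Fe i); case: (FP (c i)).
pose A := \matrix_(i < m.+1, j < m) (nth (0, [::]) (F (c i)).2 j).1.
have MA i : M (y i - \sum_j k (A i j) * mon (nth [::] w j)).
  case: (FP (c i)) => _; rewrite /lin (big_nth (0, [::])) big_mkord.
  have sz : size (F (c i)).2 = m by rewrite -(size_map snd) Fw.
  rewrite sz; congr (M (_ - _)); apply: eq_bigr => j _; rewrite mxE.
  by rewrite -(Fw i) (nth_map (0, [::])) // sz.
have [v vA v0] : exists2 v : 'rV_m.+1, v *m A = 0 & v != 0.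
  have : kermx A != 0.
    rewrite -mxrank_eq0 mxrank_ker subn_eq0 -ltnNge ltnS.
    exact: rank_leq_col.
  move=> /rowV0Pn[v /sub_kermxP vA v0]; by exists v.
(* The numerator of the sum of the fractions [v 0 i / ('X - c i)]. At [c i] only the term of index
   [i] survives, so [q] is not 0. *)
pose q : {poly K} := \sum_i v 0 i *: \prod_(j | j != i) ('X - (c j)%:P).
have [i vi] : exists i, v 0 i != 0 by apply/rV0Pn.
have q0 : q != 0.
  apply/eqP => /(congr1 (fun p => p.[c i])); rewrite horner0 horner_sum.
  rewrite (bigD1 i) //= [X in _ + X = _]big1 => [|j ji]; last first.
    rewrite eq_sym in ji.
    by rewrite hornerZ horner_prod (bigD1 i) //= hornerXsubC subrr mul0r mulr0.
  rewrite addr0 hornerZ horner_prod => /eqP; rewrite mulf_eq0 (negbTE vi) /=.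
  apply/negP/prodf_neq0 => j ji; rewrite hornerXsubC subr_eq0.
  by apply: contraNneq ji => /cinj ->.
(* Modulo [M], [g ^+ e] equals [(x - k (c i)) * y i] for each [i]. So the left side is the product
   of all [x - k (c j)] times the sum of the [k (v 0 i) * y i], which vanishes because
   [v *m A = 0]. *)
have Mq : M (g ^+ e * (map_poly k q).[x]).
  have -> : (map_poly k q).[x] =
      \sum_i k (v 0 i) * \prod_(j | j != i) (x - k (c j)).
    rewrite rmorph_sum horner_sum; apply: eq_bigr => j _ /=.
    rewrite map_polyZ hornerZ rmorph_prod horner_prod; congr (_ * _).
    by apply: eq_bigr => h _; rewrite /= map_polyXsubC hornerXsubC.
  have -> : g ^+ e * (\sum_i k (v 0 i) * \prod_(j | j != i) (x - k (c j))) =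
      \sum_i k (v 0 i) * (\prod_(j | j != i) (x - k (c j))) *
        (g ^+ e - (x - k (c i)) * y i) +
      (\prod_j (x - k (c j))) * \sum_i k (v 0 i) * y i.
    rewrite !mulr_sumr -big_split /=; apply: eq_bigr => j _.
    rewrite [in X in _ + X](bigD1 j) //= mulrBr [g ^+ e * _]mulrC.
    rewrite -[LHS]addr0 -addrA; congr (_ + _); apply/esym/eqP.
    rewrite addrC subr_eq0; apply/eqP.
    by rewrite mulrACA [RHS]mulrACA [k _ * (x - _)]mulrC.
  apply: (ideal_setD idM).
    by apply: ideal_set_sum => // j; apply: (ideal_setM idM).
  apply: (ideal_setM idM).
  have -> : \sum_i k (v 0 i) * y i =
      \sum_i k (v 0 i) * (y i - \sum_j k (A i j) * mon (nth [::] w j)).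
    rewrite -[LHS]subr0; under [RHS]eq_bigr do rewrite mulrBr.
    rewrite sumrB; congr (_ - _).
    under eq_bigr do rewrite mulr_sumr.
    rewrite exchange_big /= big1 // => j _.
    under eq_bigr do rewrite mulrA -rmorphM.
    rewrite -mulr_suml -rmorph_sum /=.
    have := congr1 (fun u : 'rV_m => u 0 j) vA; rewrite !mxE => ->.
    by rewrite rmorph0 mul0r.
  by apply: ideal_set_sum => // j; apply: (ideal_setM idM).
(* [q] splits over [K] and [M] is prime, so [M] contains some [x - k z], which was excluded. *)
have [r qE] := closed_field_poly_normal q.
move: Mq => /(maximal_avoiding_prime gM)[/(avoiding_expr gM)//|].
rewrite qE map_polyZ hornerZ.
move=> /(maximal_avoiding_prime gM)[/const_avoiding/eqP|].
  by rewrite lead_coef_eq0 (negbTE q0).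
rewrite rmorph_prod horner_prod.
elim: r {qE} => [|z r IH]; first by rewrite big_nil; have := avoiding_expr gM 0.
rewrite big_cons => /(maximal_avoiding_prime gM)[|//].
by rewrite /= map_polyXsubC hornerXsubC => Mz; apply: nx; exists z.
Qed.

(** Nonzero constants are units, hence outside [M]. So the constant congruent to [x] is unique, and
    sending [x] to it is reduction modulo [M]. *)
Lemma residue_morphism : exists f : {rmorphism R -> K},
  (forall c, f (k c) = c) /\ forall x, f x = 0 <-> M x.
Proof.
pose f x := projT1 (cid (residue_avoiding x)).
have fP x : M (x - k (f x)) := projT2 (cid (residue_avoiding x)).
have fE x c : M (x - k c) -> f x = c.
  move=> Mc; apply/eqP; rewrite -subr_eq0; apply/eqP/const_avoiding.
  rewrite rmorphB; have := ideal_setB idM Mc (fP x).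
  by rewrite opprB addrC subrKA.
have fB : zmod_morphism f.
  move=> x y; apply: fE; rewrite rmorphB opprD addrACA -opprD.
  by apply: (ideal_setB idM).
have fM : monoid_morphism f.
  split=> [|x y]; apply: fE.
    by rewrite rmorph1 subrr; apply: (ideal_set0 idM).
  have -> : x * y - k (f x * f y) = y * (x - k (f x)) + k (f x) * (y - k (f y)).
    by rewrite rmorphM !mulrBr [y * x]mulrC [y * _]mulrC subrKA.
  by apply: (ideal_setD idM); apply: (ideal_setM idM).
pose F1 := GRing.isZmodMorphism.Build R K f fB.
pose F2 := GRing.isMonoidMorphism.Build R K f fM.
pose f' : {rmorphism R -> K} := HB.pack f F1 F2.
exists f'; split => [c|x].
  by apply: fE; rewrite subrr; apply: (ideal_set0 idM).
split => [f0|Mx]; last by apply: fE; rewrite rmorph0 subr0.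
by have := fP x; rewrite [f x]f0 rmorph0 subr0.
Qed.

End Nullstellensatz.

Lemma uncountable_nullstellensatz (K : closedFieldType) (R : comNzRingType)
    (k : {rmorphism K -> R}) (s : nat -> R) (a : set R) (g : R) :
  ~ countable [set: K] ->
  (forall B : {pred R}, GRing.subring_closed B ->
    (forall c, k c \in B) -> (forall x n, x ^+ n = 0 -> x \in B) ->
    (forall i, s i \in B) -> forall x, x \in B) ->
  ideal_set a -> (forall n, ~ a (g ^+ n)) ->
  exists f : {rmorphism R -> K},
    [/\ forall c, f (k c) = c, forall x, a x -> f x = 0 & f g != 0].
Proof.
move=> ncK gen ida ag; have [M gM aM] := maximal_avoiding_ex ida ag.
have [f [fk fM]] := residue_morphism ncK gen gM.
exists f; split => // [x ax|]; first by apply/fM/aM.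
by apply/eqP => /fM; rewrite -[g]expr1; apply: (avoiding_expr gM).
Qed.

(** * Differential polynomials and retractions onto Hurwitz series *)

Section MonomialEvaluation.
Context (V : choiceType) (S : comNzRingType) (z : V -> S).

Definition cmonom_eval (m : {cmonom V}) : S :=
  \prod_(v <- finsupp m) z v ^+ m v.

Lemma cmonom_evalEw (m : {cmonom V}) (d : {fset V}) : (finsupp m `<=` d)%fset ->
  cmonom_eval m = \prod_(v <- d) z v ^+ m v.
Proof.
move=> le; rewrite /cmonom_eval (big_fset_incl _ le) // => v _ vm.
by rewrite fsfun_dflt.
Qed.

Lemma cmonom_eval_is_mmorphism : mmorphism cmonom_eval.
Proof.
split=> [m1 m2|]; last by rewrite /cmonom_eval mdom1 big_seq_fset0.
rewrite (@cmonom_evalEw m1 (finsupp m1 `|` finsupp m2)%fset) ?fsubsetUl //.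
rewrite (@cmonom_evalEw m2 (finsupp m1 `|` finsupp m2)%fset) ?fsubsetUr //.
rewrite (@cmonom_evalEw _ (finsupp m1 `|` finsupp m2)%fset) ?mdomD //.
rewrite -big_split /=; apply: eq_bigr => v _; rewrite -exprD.
by congr (_ ^+ _); apply: mulcmE.
Qed.

HB.instance Definition _ := monalg.isMultiplicative.Build _ S cmonom_eval
  cmonom_eval_is_mmorphism.

Lemma cmonom_evalX v : cmonom_eval (ucm v) = z v.
Proof.
rewrite (@cmonom_evalEw _ [fset v]%fset) ?mdomU // big_seq_fset1.
by have -> : ucm v v = 1%N by rewrite ucmE eqxx.
Qed.

End MonomialEvaluation.

(* These constants are locked because unification would otherwise unfold
   monoid algebras. *)
HB.lock Definition dpoly_const (Delta : finType) (Q : diffRingType Delta) n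
    (c : Q) : dpoly Q n := malgC c.

HB.lock Definition dpoly_var (Delta : finType) (Q : diffRingType Delta) n
    (v : dvar Delta n) : dpoly Q n := << ucm v >>.

HB.lock Definition dpoly_eval (Delta : finType) (Q L : diffRingType Delta) n
    (i : {rmorphism Q -> L}) (s : 'I_n -> L) (f : dpoly Q n) : L :=
  mmap i (cmonom_eval (fun v : dvar Delta n => theta_act v.2 (s v.1))) f.

Section DPolyTheory.
Context (Delta : finType) (Q : diffRingType Delta) (n : nat).
Local Notation P := (dpoly Q n).
Local Notation dpoly_const := (@dpoly_const Delta Q n).
Local Notation dpoly_var := (@dpoly_var Delta Q n).

Lemma dpoly_const_is_zmod_morphism : zmod_morphism dpoly_const.
Proof. rewrite unlock; exact: (rmorphB (@malgC _ Q)). Qed.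

Lemma dpoly_const_is_monoid_morphism : monoid_morphism dpoly_const.
Proof.
rewrite unlock; split; [exact: (rmorph1 (@malgC _ Q))|].
exact: (rmorphM (@malgC _ Q)).
Qed.

HB.instance Definition _ := GRing.isZmodMorphism.Build Q P dpoly_const
  dpoly_const_is_zmod_morphism.
HB.instance Definition _ := GRing.isMonoidMorphism.Build Q P dpoly_const
  dpoly_const_is_monoid_morphism.

Lemma dpoly_ind (A : P -> Prop) : (forall c, A (dpoly_const c)) ->
  (forall v, A (dpoly_var v)) -> (forall f g, A f -> A g -> A (f + g)) ->
  (forall f g, A f -> A g -> A (f * g)) -> forall f, A f.
Proof.
move=> AC AX AD AM.
elim/malg_ind => [c m|f g Af Ag]; last exact: (AD _ _ Af Ag).
have -> : << c *g m >> = dpoly_const c * << m >> :> P.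
  by rewrite unlock [RHS]malgUM mulr1 mul1m.
apply: (AM _ _ (AC c)).
elim/cmonom_ind: m => [|v|k l Ak Al]; [|have := AX v; rewrite unlock //|].
  have := AC 1; rewrite unlock; exact.
have -> : << mmul k l >> = << k >> * << l >> :> P by rewrite [RHS]malgUM mulr1.
exact: (AM _ _ Ak Al).
Qed.

Lemma der_dpoly_const d c : der d (dpoly_const c) = dpoly_const (der d c).
Proof.
rewrite unlock [LHS](malg_derivU (derD d)) /cmonom_deriv mdom1 big_seq_fset0.
rewrite scaler0; exact: addr0.
Qed.

Lemma der_dpoly_var d v : der d (dpoly_var v) = dpoly_var (dvar_deriv d v).
Proof. rewrite unlock; exact: (dpoly_derivX Q d v). Qed.

Lemma theta_act_dpoly_var g i :
  theta_act g (dpoly_var (i, theta0 Delta)) = dpoly_var (i, g).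
Proof.
elim/theta_ind: g => [|d g IH]; first by rewrite theta_act0.
rewrite theta_act_incr -der_theta_act IH der_dpoly_var; reflexivity.
Qed.

Section Evaluation.
Context (L : diffRingType Delta) (i : {rmorphism Q -> L}) (s : 'I_n -> L).

Local Notation ev :=
  (mmap i (cmonom_eval (fun v : dvar Delta n => theta_act v.2 (s v.1)))).

Lemma dpoly_eval_is_zmod_morphism : zmod_morphism (dpoly_eval i s).
Proof. rewrite unlock; exact: (rmorphB ev). Qed.

Lemma dpoly_eval_is_monoid_morphism : monoid_morphism (dpoly_eval i s).
Proof.
by rewrite unlock; split; [exact: (rmorph1 ev) | exact: (rmorphM ev)].
Qed.

HB.instance Definition _ := GRing.isZmodMorphism.Build P L (dpoly_eval i s)
  dpoly_eval_is_zmod_morphism.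
HB.instance Definition _ := GRing.isMonoidMorphism.Build P L (dpoly_eval i s)
  dpoly_eval_is_monoid_morphism.

Lemma dpoly_evalC c : dpoly_eval i s (dpoly_const c) = i c.
Proof. rewrite !unlock; exact: (mmapC (h := cmonom_eval _)). Qed.

Lemma dpoly_evalX v : dpoly_eval i s (dpoly_var v) = theta_act v.2 (s v.1).
Proof.
rewrite !unlock [LHS](mmapU (h := cmonom_eval _)) /= rmorph1 mul1r.
exact: cmonom_evalX.
Qed.

Lemma dpoly_eval_der d f : (forall d x, i (der d x) = der d (i x)) ->
  dpoly_eval i s (der d f) = der d (dpoly_eval i s f).
Proof.
have evD x y : dpoly_eval i s (x + y) = dpoly_eval i s x + dpoly_eval i s y.
  exact: rmorphD.
have evM x y : dpoly_eval i s (x * y) = dpoly_eval i s x * dpoly_eval i s y.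
  exact: rmorphM.
move=> ider; elim/dpoly_ind: f => [c|v|f g IHf IHg|f g IHf IHg].
- by rewrite der_dpoly_const !dpoly_evalC ider.
- by rewrite der_dpoly_var !dpoly_evalX der_theta_act -theta_act_incr.
- rewrite derD (evD f) derD -IHf -IHg; exact: evD.
- rewrite derM (evM f) derM -IHf -IHg -!evM; exact: evD.
Qed.

End Evaluation.

Lemma devalE (q : 'I_n -> Q) f : deval q f = dpoly_eval idfun q f.
Proof. by rewrite unlock. Qed.

End DPolyTheory.

Lemma bijective_surj (T U : Type) (f : T -> U) :
  injective f -> (forall y, exists x, f x = y) -> bijective f.
Proof.
move=> fI fS; pose g y := projT1 (cid (fS y)).
have gK : cancel g f by move=> y; apply: projT2 (cid (fS y)).
by exists g => // x; apply: fI; rewrite gK.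
Qed.

Lemma rmorphism_lift (R S T : comNzRingType) (j : {rmorphism S -> T})
    (f : {rmorphism R -> T}) : injective j -> (forall x, exists y, j y = f x) ->
  exists h : {rmorphism R -> S}, forall x, j (h x) = f x.
Proof.
move=> jI jf; pose h x := projT1 (cid (jf x)).
have hP x : j (h x) = f x := projT2 (cid (jf x)).
have hB : zmod_morphism h by move=> x y; apply: jI; rewrite rmorphB !hP rmorphB.
have hM : monoid_morphism h.
  by split=> [|x y]; apply: jI; rewrite ?rmorphM !hP ?rmorphM ?rmorph1.
pose H1 := GRing.isZmodMorphism.Build R S h hB.
pose H2 := GRing.isMonoidMorphism.Build R S h hM.
by pose h' : {rmorphism R -> S} := HB.pack h H1 H2; exists h'.
Qed.

Lemma countable_enum (T : choiceType) (x0 : T) (C : set T) : countable C ->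
  exists s : nat -> T, forall x, C x -> exists n, s n = x.
Proof.
move=> /pcard_leP[f]; pose P n x := C x /\ f x = n.
exists (fun n => xget x0 (P n)) => x Cx; exists (f x).
case: xgetP => [y -> [Cy fy]|/(_ x) []//].
by apply: (@inj _ _ _ f); rewrite ?inE.
Qed.

Section Retraction.
Context (Delta : finType) (Q : diffRingType Delta) (K : closedFieldType).
Context (k : {rmorphism K -> Q}) (r : {rmorphism Q -> K}).
Hypothesis uncountableK : ~ countable [set: K].
Hypothesis Qq : quasifield Q.
Hypothesis rk : forall c, r (k c) = c.
Hypothesis taylor_surj : forall h : hurwitz Delta K, exists q, taylor r q = h.

Let r_nil q : r q = 0 -> exists n, q ^+ n = 0.
Proof.
move=> rq; have [p pQ] := quasifield_pchar Qq; exists p.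
have [//|[y qy]] := quasifield_unit_or_nil Qq q pQ.
by have /eqP := congr1 r qy; rewrite rmorphM rq mul0r rmorph1 eq_sym oner_eq0.
Qed.

(** [R] is generated by constants from [K], nilpotents and the countable set [C], so it has a
    [K]-point [phi] that kills [a] but not [g]. The Taylor morphism of [phi] lands in [H K],
    identified with [Q] by [taylor r], and kills [a] because [a] is differential. *)
Lemma hurwitz_retraction (R : diffRingType Delta) (i : {rmorphism Q -> R})
    (C : set R) (a : set R) (g : R) :
  (forall d x, i (der d x) = der d (i x)) -> countable C ->
  (forall B : {pred R}, GRing.subring_closed B -> (forall q, i q \in B) ->
    (forall x, C x -> x \in B) -> forall x, x \in B) ->
  diff_ideal a -> (forall n, ~ a (g ^+ n)) ->
  exists f : {rmorphism R -> Q}, [/\ forall d x, f (der d x) = der d (f x),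
    forall q, f (i q) = q, forall x, a x -> f x = 0 & f g != 0].
Proof.
move=> ider Cc gen ida ag.
have [s sP] := countable_enum 0 Cc.
have ida' : ideal_set a.
  by split; [apply: diff_ideal0 | apply: diff_idealD | apply: diff_idealM].
have [|phi [phik phia phig]] :=
    @uncountable_nullstellensatz K R (i \o k) s a g uncountableK _ ida' ag.
  move=> B cB Bk Bnil Bs; apply: gen => // [q|x /sP[n <-]//].
  have [B1 BB BM] := cB.
  have B0 : 0 \in B by rewrite -(subrr 1) BB.
  have BD x y : x \in B -> y \in B -> x + y \in B.
    by move=> Bx By; rewrite -[y]opprK -[- y]sub0r !BB.
  rewrite -[q](subrK (k (r q))) rmorphD BD // ?Bk //.
  have [|n nq] := @r_nil (q - k (r q)); first by rewrite rmorphB rk subrr.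
  by apply: (Bnil _ n); rewrite -rmorphXn nq rmorph0.
(* [q - k (r q)] is nilpotent and is killed by [phi], so [phi] restricts to [r] on [Q]. *)
have phii q : phi (i q) = r q.
  have [|n nq] := @r_nil (q - k (r q)); first by rewrite rmorphB rk subrr.
  have /eqP := congr1 (fun x => phi (i x)) nq.
  rewrite !rmorphXn !rmorph0 expf_eq0 !rmorphB subr_eq0 => /andP[_ /eqP ->].
  exact: phik.
have tI : injective (taylor r).
  by apply: quasifield_inj => //; apply: taylor_der.
have [x|f fE] := @rmorphism_lift R Q _ (taylor r) (taylor phi) tI.
  exact: taylor_surj.
have fr x : r (f x) = phi x.
  have := congr1 (fun h : hurwitz Delta K => h (theta0 Delta)) (fE x).
  by rewrite /= !taylor0E.
exists f; split.
- by move=> d x; apply: tI; rewrite [RHS]taylor_der !fE; apply: taylor_der.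
- move=> q; apply: tI; rewrite fE; apply/funext => h.
  by have := phii (theta_act h q); rewrite (morph_theta_act _ _ ider).
- move=> x ax; apply: tI; rewrite fE rmorph0; apply/funext => h.
  exact: (phia _ (diff_ideal_theta h ida ax)).
- by apply: contraNneq phig => fg0; rewrite -fr fg0 rmorph0.
Qed.

End Retraction.

(** * The equivalences *)

Section ClosedFields.
Context (F : fieldType) (closedF : GRing.closed_field_axiom F).

(** An alias indexed by the axiom can bear the closed field structure while staying convertible to
    [F]. *)
Definition closed_copy & GRing.closed_field_axiom F : Type := F.

HB.instance Definition _ := GRing.Field.copy (closed_copy closedF) F.
HB.instance Definition _ :=
  Field_isAlgClosed.Build (closed_copy closedF) closedF.

End ClosedFields.

Section Implications.
Context (Delta : finType) (Q : diffRingType Delta).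
Hypothesis Qq : quasifield Q.

Definition all_zeros_nonempty := forall n (a : set (dpoly Q n)),
  diff_ideal a -> a <> [set: dpoly Q n] -> zeros a !=set0.

Definition no_simple_ext :=
  forall (L : diffRingType Delta) (i : {rmorphism Q -> L}),
    quasifield_ext i -> (exists s : L, diff_generated i [set s]) -> bijective i.

Definition no_countable_ext :=
  forall (L : diffRingType Delta) (i : {rmorphism Q -> L}),
    quasifield_ext i ->
    (exists2 S : set L, countable S & diff_generated i S) -> bijective i.

Definition uncountable_hurwitz := exists2 K : closedFieldType,
  ~ countable [set: K] & diff_ring_isomorphic Q (hurwitz Delta K).

Lemma diff_closed_zeros : diff_closed Q -> all_zeros_nonempty.
Proof.
move=> cQ n a ida na; apply: contrapT => /nonemptyPn za; apply: na.
have : diff_rad a 1 by rewrite cQ // => q; rewrite za.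
move=> /(_ (theta0 Delta))[k]; rewrite theta_act0 expr1n => a1.
by apply/seteqP; split => // x _; rewrite -[x]mulr1; apply: diff_idealM.
Qed.

Lemma dpoly_eval_surj (L : diffRingType Delta) (i : {rmorphism Q -> L}) s :
  diff_generated i [set s] ->
  forall x, exists f, dpoly_eval (n := 1) i (fun=> s) f = x.
Proof.
move=> gen x; set ev := dpoly_eval i _.
pose B : {pred L} := [pred x | `[< exists f, ev f = x >]].
suff /asboolP : x \in B by [].
apply: gen => [|q|g _ ->].
- split; first by apply/asboolP; exists 1; apply: rmorph1.
    move=> _ _ /asboolP[f <-] /asboolP[f' <-]; apply/asboolP.
    by exists (f - f'); apply: rmorphB.
  move=> _ _ /asboolP[f <-] /asboolP[f' <-]; apply/asboolP.
  by exists (f * f'); apply: rmorphM.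
- by apply/asboolP; exists (dpoly_const 1 q); apply: dpoly_evalC.
- by apply/asboolP; exists (dpoly_var Q (ord0, g)); apply: dpoly_evalX.
Qed.

(** [L] is the quotient of the differential polynomials by the kernel [a] of evaluation at [s].
    Evaluation at a zero of [a] in [Q] also kills [a], and simplicity of [L] makes both kernels
    equal. Hence [f] and the constant [eq f] have the same image in [L]. *)
Lemma zeros_no_simple_ext : all_zeros_nonempty -> no_simple_ext.
Proof.
move=> HZ L i [Lq iI ider] [s gen].
have surj := dpoly_eval_surj gen; set ev := dpoly_eval i _ in surj.
have evder d f : ev (der d f) = der d (ev f) by apply: dpoly_eval_der.
have evD f f' : ev (f + f') = ev f + ev f' by apply: rmorphD.
have evM f f' : ev (f * f') = ev f * ev f' by apply: rmorphM.
have ev0 : ev 0 = 0 by apply: rmorph0.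
have ev1 : ev 1 = 1 by apply: rmorph1.
pose a := [set f | ev f = 0].
have ida : diff_ideal a.
  split => [|f f' f0 f'0|r f f0|d f f0]; rewrite /a /= ?ev0 //.
  - by rewrite evD f0 f'0 addr0.
  - by rewrite evM f0 mulr0.
  - by rewrite evder f0 der0.
have [|q zq] := HZ _ a ida.
  move=> aT; have : a 1 by rewrite aT.
  by rewrite /a /= ev1 => /eqP; rewrite oner_eq0.
pose eq := dpoly_eval (idfun : {rmorphism Q -> Q}) q.
have eqD f f' : eq (f + f') = eq f + eq f' by apply: rmorphD.
have eqB f f' : eq (f - f') = eq f - eq f' by apply: rmorphB.
have eqM f f' : eq (f * f') = eq f * eq f' by apply: rmorphM.
have eqder d f : eq (der d f) = der d (eq f) by apply: dpoly_eval_der.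
have eqa f : ev f = 0 -> eq f = 0 by move=> f0; rewrite /eq -devalE; apply: zq.
have evB f f' : ev (f - f') = ev f - ev f' by apply: rmorphB.
(* The image under [ev] of the kernel of [eq] is a differential ideal of [L]. If it contained 1,
   some [u - 1] in [a] would have value -1 under [eq]. *)
have evq f : eq f = 0 -> ev f = 0.
  move=> fq; apply: (@quasifield_ideal _ _ Lq
      [set x | exists2 f, eq f = 0 & ev f = x]); last by exists f.
  - split.
    + by exists 0; [apply: eqa|].
    + move=> _ _ [u u0 <-] [v v0 <-].
      by exists (u + v); rewrite ?eqD ?u0 ?v0 ?addr0 ?evD.
    + move=> r _ [u u0 <-]; have [v <-] := surj r.
      by exists (v * u); rewrite ?eqM ?u0 ?mulr0 ?evM.
    + by move=> d _ [u u0 <-]; exists (der d u); rewrite ?eqder ?u0 ?der0.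
  - move=> [u u0 u1].
    have : eq (u - 1) = 0 by apply: eqa; rewrite evB u1 ev1 subrr.
    rewrite eqB u0 [eq 1]rmorph1 sub0r => /eqP.
    by rewrite oppr_eq0 oner_eq0.
apply: bijective_surj => // x; have [f <-] := surj x; exists (eq f).
have evC c : ev (dpoly_const 1 c) = i c by apply: dpoly_evalC.
have eqC c : eq (dpoly_const 1 c) = c by apply: dpoly_evalC.
apply/esym/eqP; rewrite -subr_eq0 -evC -evB; apply/eqP/evq.
by rewrite eqB eqC subrr.
Qed.

(* [L] is the differential subring generated by [h] and the image of [Q]; the
   hypothesis on [h] makes its residue ring a field. *)
Lemma no_simple_ext_taylor (F : fieldType) (r : {rmorphism Q -> F})
    (h : hurwitz Delta F) : no_simple_ext ->
  (forall B : {pred F}, GRing.subring_closed B -> (forall q, r q \in B) ->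
    (forall g, h g \in B) -> forall c, c \in B -> c^-1 \in B) ->
  exists q, taylor r q = h.
Proof.
move=> simpleQ Binv; pose H := hurwitz Delta F.
pose gens (B : {pred H}) := [/\ GRing.subring_closed B,
  forall q, taylor r q \in B & forall g, theta_act g h \in B].
pose S : {pred H} := [pred x | `[< forall B, gens B -> x \in B >]].
have cS : GRing.subring_closed S.
  split; first by apply/asboolP => B [[]].
    move=> x y /asboolP Sx /asboolP Sy; apply/asboolP => B gB.
    by have [[_ BB _] _ _] := gB; apply: BB; [apply: Sx | apply: Sy].
  move=> x y /asboolP Sx /asboolP Sy; apply/asboolP => B gB.
  by have [[_ _ BM] _ _] := gB; apply: BM; [apply: Sx | apply: Sy].
have dS d x : x \in S -> der d x \in S.
  move=> /asboolP Sx; apply/asboolP => B gB; have [[B1 BB BM] Bq Bh] := gB.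
  have B0 : 0 \in B by rewrite -(subrr 1) BB.
  have BD u v : u \in B -> v \in B -> u + v \in B.
    by move=> Bu Bv; rewrite -[v]opprK -[- v]sub0r !BB.
  (* The elements of [B] whose derivative stays in [B] again form a subring containing the
     generators, so the smallest such subring is stable under [d]. *)
  pose B' : {pred H} := [pred x | (x \in B) && (der d x \in B)].
  suff /Sx /andP[] : gens B' by [].
  split=> [|q|g].
  - split; first by rewrite inE B1 der1 B0.
      move=> u v /andP[Bu Bdu] /andP[Bv Bdv].
      by rewrite inE BB //= derD derN BB.
    move=> u v /andP[Bu Bdu] /andP[Bv Bdv].
    by rewrite inE BM //= derM BD // BM.
  - by rewrite inE Bq /= -taylor_der Bq.
  - by rewrite inE Bh /= der_theta_act -theta_act_incr Bh.
have Sq q : taylor r q \in S by apply/asboolP => B [].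
have Sh g : theta_act g h \in S by apply/asboolP => B [].
have [L [j [jI jd jS Sj]]] := diff_subring cS dS.
have [i iE] := rmorphism_lift jI (fun q => Sj _ (Sq q)).
have id d q : i (der d q) = der d (i q).
  by apply: jI; rewrite jd !iE [LHS]taylor_der.
have [s sE] : exists s, j s = h.
  by apply: Sj; have := Sh (theta0 Delta); rewrite theta_act0.
have [p pQ] := quasifield_pchar Qq.
have Lq : quasifield L.
  apply: (@quasifieldP _ L F (@hurwitz_ev0 Delta F \o j) p).
  - exact: rmorph_pchar i _ pQ.
  - move=> x x0; apply: jI; rewrite rmorph0; apply/funext => g.
    by have := x0 g; rewrite /= (morph_theta_act _ _ jd) [LHS]hurwitz_theta_act.
  - move=> x x0.
    (* The constant terms of [L] form a subring that contains all [r q] and all coefficients of [h],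
       so [Binv] applies to it. *)
    pose B : {pred F} := [pred c | `[< exists y, hurwitz_ev0 (j y) = c >]].
    have /asboolP[y yx] : (hurwitz_ev0 (j x))^-1 \in B.
      apply: Binv; last by apply/asboolP; exists x.
      - split; first by apply/asboolP; exists 1; rewrite !rmorph1.
          move=> _ _ /asboolP[u <-] /asboolP[v <-]; apply/asboolP.
          by exists (u - v); rewrite !rmorphB.
        move=> _ _ /asboolP[u <-] /asboolP[v <-]; apply/asboolP.
        by exists (u * v); rewrite !rmorphM.
      - by move=> q; apply/asboolP; exists (i q); rewrite iE [LHS]taylor0E.
      - move=> g; apply/asboolP; exists (theta_act g s).
        by rewrite (morph_theta_act _ _ jd) sE; apply: hurwitz_theta_act.
    by exists y; rewrite rmorphM /= yx mulfV.
have gen : diff_generated i [set s].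
  move=> B [B1 BB BM] Bi Bs x.
  pose B' : {pred H} := [pred z | `[< exists2 y, y \in B & j y = z >]].
  suff /asboolP[y By /jI <-] : j x \in B' by [].
  have /asboolP := jS x; apply; split.
  - split; first by apply/asboolP; exists 1; rewrite ?rmorph1.
      move=> _ _ /asboolP[u Bu <-] /asboolP[v Bv <-]; apply/asboolP.
      by exists (u - v); rewrite ?rmorphB // BB.
    move=> _ _ /asboolP[u Bu <-] /asboolP[v Bv <-]; apply/asboolP.
    by exists (u * v); rewrite ?rmorphM // BM.
  - by move=> q; apply/asboolP; exists (i q); rewrite ?Bi ?iE.
  - move=> g; apply/asboolP; exists (theta_act g s); first exact: Bs.
    by rewrite (morph_theta_act _ _ jd) sE.
have iI : injective i by apply: quasifield_inj.
have [i' _ i'K] := simpleQ L i (QuasifieldExt Lq iI id) (ex_intro _ s gen).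
by exists (i' s); rewrite -iE i'K.
Qed.

(** By induction on the degree, [p] may be taken irreducible, with a root [z] in a finite extension
    [L]. Subrings of [L] containing [F] are closed under inverses, as the inverse of [c] is a
    polynomial in [c]. So the series with all coefficients [z] comes from [Q], and its constant term
    lies in [F]. *)
Lemma no_simple_ext_root (F : fieldType) (r : {rmorphism Q -> F}) :
  no_simple_ext -> (forall c, exists q, r q = c) ->
  forall p : {poly F}, (1 < size p)%N -> exists c, root p c.
Proof.
move=> simpleQ rS p; have [n] := ubnP (size p).
elim: n p => // n IH p; rewrite ltnS => lt p1.
have [irr|/existsNP[q]] := pselect (forall q : {poly F},
    size q != 1 -> q %| p -> q %= p); last first.
  move=> /not_implyP[q1 /not_implyP[qp nqp]].
  have p0 : p != 0 by rewrite -size_poly_gt0 (ltn_trans _ p1).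
  have ltq : (size q < size p)%N.
    rewrite ltn_neqAle dvdp_leq // andbT.
    by apply: contra_notN nqp => sq; rewrite -(dvdp_size_eqp qp).
  have q0 : q != 0 by apply: dvdpN0 p0.
  have [||c qc] := IH q; first exact: leq_trans ltq lt.
    by move: q1 q0; rewrite -size_poly_gt0; case: size => [|[]].
  by exists c; move: qc; rewrite -!dvdp_XsubCl => /dvdp_trans; apply.
have [L _ [z pz _]] := irredp_FAdjoin (conj p1 irr).
have [|q qz] := @no_simple_ext_taylor L (in_alg L \o r) (fun=> z) simpleQ.
  move=> B [B1 BB BM] Br _ c Bc.
  have BF b : b%:A \in B by have [q <-] := rS b; apply: Br.
  have B0 : 0 \in B by rewrite -(subrr 1) BB.
  have BD x y : x \in B -> y \in B -> x + y \in B.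
    by move=> Bx By; rewrite -[y]opprK -[- y]sub0r !BB.
  have cV : c^-1 \in <<1; c>>%VS by rewrite memvV memv_adjoin.
  rewrite -(Fadjoin_poly_eq cV) horner_coef.
  apply: (big_ind (fun x => x \in B)) => // i _; apply: (BM).
    have /polyOverP/(_ i)/vlineP[b ->] := Fadjoin_polyOver 1 c (c^-1).
    exact: BF.
  by elim: {i}(val i) => [|i IHi]; rewrite ?expr0 // exprS BM.
exists (r q); have := congr1 (fun x : hurwitz Delta L => x (theta0 Delta)) qz.
rewrite [LHS]taylor0E /= => rz.
by move: pz; rewrite -rz; rewrite fmorph_root.
Qed.

(** If [F] were countable, so would be F(t). A series whose coefficients exhaust F(t) would come
    from [Q] and thus have all its coefficients in [F]. The exponent of [d0] serves to number the
    coefficients. *)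
Lemma no_simple_ext_uncountable (d0 : Delta) (F : fieldType)
    (r : {rmorphism Q -> F}) : no_simple_ext -> ~ countable [set: F].
Proof.
move=> simpleQ cF; have [s sP] := countable_enum 0 cF.
pose E := {fraction {poly F}}.
(* A fraction is coded by the numbers of its coefficients. A zero denominator yields a default
   value, harmless since only surjectivity is used. *)
pose frac (l : seq nat * seq nat) : E :=
  \pi_{fraction {poly F}} (Ratio (Poly (map s l.1)) (Poly (map s l.2))).
pose e m : E := if choice.unpickle m is Some l then frac l else 0.
have polyS (p : {poly F}) : exists l, Poly (map s l) = p.
  suff [l lp] : exists l, map s l = p :> seq F by exists l; rewrite lp polyseqK.
  elim: (p : seq F) => [|c cs [l <-]]; first by exists [::].
  by have [m <-] := sP c I; exists (m :: l).
have eS x : exists m, e m = x.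
  elim/quotW: x => x; have [l1 E1] := polyS \n_x; have [l2 E2] := polyS \d_x.
  exists (choice.pickle (l1, l2)).
  by rewrite /e choice.pickleK /frac /= E1 E2 Ratio_numden.
have [|q qe] := @no_simple_ext_taylor E (@tofrac _ \o polyC \o r)
    (fun g => e (g d0)) simpleQ.
  move=> B _ _ Be c _; have [m <-] := eS c^-1.
  by have := Be [ffun=> m]; rewrite ffunE.
have [m em] := eS (tofrac 'X).
have := congr1 (fun x : hurwitz Delta E => x [ffun=> m]) qe.
rewrite ffunE em /taylor /= => /eqP; rewrite tofrac_eq => /eqP.
move=> /(congr1 (fun p : {poly F} => size p)).
by rewrite size_polyX size_polyC; case: eqP.
Qed.

Lemma no_simple_ext_hurwitz (d0 : Delta) : no_simple_ext -> uncountable_hurwitz.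
Proof.
move=> simpleQ; have [F [r rS]] := residue_field Qq.
have closedF : GRing.closed_field_axiom F.
  move=> n P n0; pose p := 'X^n - \poly_(i < n) P i.
  have [|c] := no_simple_ext_root simpleQ rS (p := p).
    by rewrite size_polyDl ?size_polyXn // size_polyN ltnS size_poly.
  rewrite /root /p !hornerE horner_poly subr_eq0 => /eqP cE; by exists c.
pose K : closedFieldType := closed_copy closedF.
exists K; first exact: (no_simple_ext_uncountable d0 r simpleQ).
exists (taylor r : {rmorphism Q -> hurwitz Delta K}); last exact: taylor_der.
apply: bijective_surj.
  by apply: quasifield_inj => //; apply: taylor_der.
(* Over the residue field itself the condition on inverses is automatic, [r] being onto. *)
move=> h; apply: (no_simple_ext_taylor simpleQ) => B _ Br _ c _.
by have [q <-] := rS c^-1; apply: Br.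
Qed.

(** [k] and [r] are the constant series and the constant term, carried over by the isomorphism [f].
    As [f] commutes with derivations, it agrees with [taylor r] coefficient by coefficient. *)
Lemma uncountable_hurwitzE : uncountable_hurwitz ->
  exists (K : closedFieldType) (k : {rmorphism K -> Q})
         (r : {rmorphism Q -> K}),
    [/\ ~ countable [set: K], forall c, r (k c) = c &
        forall h : hurwitz Delta K, exists q, taylor r q = h].
Proof.
move=> [K ncK [f fbij fd]]; have fI := bij_inj fbij.
have fS y : exists q, f q = y by case: fbij => g _ gK; exists (g y).
have [k kE] :=
  @rmorphism_lift K Q _ f (@hurwitz_const Delta K) fI (fun c => fS _).
exists K, k, (@hurwitz_ev0 Delta K \o f); split => // [c|h].
  by rewrite /= kE; apply: hurwitz_const0.
have [q fq] := fS h; exists q; apply/funext => g.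
by rewrite -fq -[RHS]hurwitz_theta_act -(morph_theta_act _ _ fd).
Qed.

(** The retraction for the zero ideal and [g = 1] is injective because [L] is a quasifield, and an
    injective retraction is an inverse of [i]. *)
Lemma hurwitz_no_countable_ext : uncountable_hurwitz -> no_countable_ext.
Proof.
move=> /uncountable_hurwitzE[K [k [r [ncK rk tS]]]] L i [Lq iI ider] [S cS gen].
have id0 : diff_ideal [set 0 : L].
  by split => [|_ _ -> ->|? _ ->|d _ ->]; rewrite /= ?addr0 ?mulr0 ?der0.
pose C := [set theta_act x.1 x.2 | x in [set: Theta Delta] `*` S].
have cC : countable C.
  apply: sub_countable (card_image_le _ _) (countableX _ cS).
  exact: countableP.
have [|n /eqP|f [fd fi _ _]] :=
  @hurwitz_retraction _ Q K k r ncK Qq rk tS L i C [set 0] 1 ider cC _ id0.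
- move=> B cB Bi BC; apply: gen => // g s Ss.
  by apply: BC; exists (g, s).
- by rewrite expr1n oner_eq0.
have fI : injective f by apply: quasifield_inj.
by exists f => // x; apply: fI; rewrite fi.
Qed.

(** At a zero of [a], all derivatives of the value of [f] are nilpotent, so this value is 0.
    Conversely, if no power of some derivative of [f] lies in [a], a retraction that kills [a] but
    not this derivative yields a zero of [a] at which [f] does not vanish. *)
Lemma hurwitz_diff_closed : uncountable_hurwitz -> diff_closed Q.
Proof.
move=> /uncountable_hurwitzE[K [k [r [ncK rk tS]]]] n a ida.
apply/seteqP; split => [f rf q zq|f vf].
  apply: (quasifield_theta_nil Qq) => g; have [m am] := rf g; exists m.
  rewrite devalE -(morph_theta_act g f (f := dpoly_eval idfun q)); last first.
    by move=> d x; apply: dpoly_eval_der.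
  by rewrite -rmorphXn -(zq _ am) devalE.
move=> g; apply: contrapT => /forallNP ag.
have cC : countable (range (@dpoly_var Delta Q n)).
  apply: sub_countable (card_image_le _ _) _.
  exact: (@countableP ('I_n * Theta Delta)%type).
have [|psi [pd pC pa pg]] := @hurwitz_retraction _ Q K k r ncK Qq rk tS
   (dpoly Q n) (@dpoly_const _ Q n) _ a (theta_act g f)
   (fun d c => esym (der_dpoly_const n d c)) cC _ ida ag.
  move=> B [B1 BB BM] Bc Bv x.
  have B0 : 0 \in B by rewrite -(subrr 1) BB.
  elim/dpoly_ind: x => [c|v|u v Bu Bv'|u v]; [exact: Bc | | | exact: BM].
    by apply: Bv; exists v.
  by rewrite -[v]opprK -[- v]sub0r !BB.
pose q i := psi (dpoly_var Q (i, theta0 Delta)).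
have psiE x : psi x = deval q x.
  rewrite devalE; elim/dpoly_ind: x => [c|[i h]|u v IHu IHv|u v IHu IHv].
  - by rewrite pC dpoly_evalC.
  - by rewrite dpoly_evalX -(morph_theta_act _ _ pd) theta_act_dpoly_var.
  - by rewrite rmorphD IHu IHv; apply/esym/rmorphD.
  - by rewrite rmorphM IHu IHv; apply/esym/rmorphM.
case/eqP: pg; rewrite (morph_theta_act _ _ pd) psiE vf; last first.
  by move=> x ax; rewrite -psiE pa.
elim/theta_ind: g {ag} => [|d g IH]; first by rewrite theta_act0.
by rewrite theta_act_incr der0.
Qed.

End Implications.

Theorem theorem11 (Delta : finType) (Delta_neq0 : (0 < #|Delta|)%N)
    (Q : diffRingType Delta) (Q_quasifield : quasifield Q) :
  [<-> diff_closed Q;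
       forall (n : nat) (a : set (dpoly Q n)),
         diff_ideal a -> a <> [set: dpoly Q n] -> zeros a !=set0;
       forall (L : diffRingType Delta) (i : {rmorphism Q -> L}),
         quasifield_ext i ->
         (exists2 S : set L, finite_set S & diff_generated i S) ->
         bijective i;
       forall (L : diffRingType Delta) (i : {rmorphism Q -> L}),
         quasifield_ext i ->
         (exists s : L, diff_generated i [set s]) ->
         bijective i;
       forall (L : diffRingType Delta) (i : {rmorphism Q -> L}),
         quasifield_ext i ->
         (exists2 S : set L, countable S & diff_generated i S) ->
         bijective i;
       exists2 K : closedFieldType, ~ countable [set: K] &
         diff_ring_isomorphic Q (hurwitz Delta K)].
Proof.
have [d0 _] := card_gt0P Delta_neq0.
have simple_hurwitz := no_simple_ext_hurwitz Q_quasifield d0.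
have hurwitz_countable := hurwitz_no_countable_ext Q_quasifield.
have countable_simple : no_countable_ext Q -> no_simple_ext Q.
  move=> H L i Li [s gen]; apply: H => //.
  by exists [set s]; first exact: countable1.
(* The substantial arrows lead from [all_zeros_nonempty] to [no_simple_ext], on to
   [uncountable_hurwitz], and from there to [no_countable_ext] and to [diff_closed]. The other links
   are composites of these with restrictions to smaller generating sets. *)
tfae.
- exact: diff_closed_zeros.
- move=> /zeros_no_simple_ext/simple_hurwitz/hurwitz_countable H.
  move=> L i Li [S fS gen]; apply: H => //.
  by exists S => //; apply: finite_set_countable.
- by move=> H L i Li [s gen]; apply: H => //; exists [set s].
- by move=> /simple_hurwitz/hurwitz_countable.
- by move=> /countable_simple/simple_hurwitz.
- exact: hurwitz_diff_closed.
Qed.
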